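(* Let $G$ be a finite simple graph with independence number $\alpha(G)\leq 2$. Then for every positive integer $\ell$ with $\ell<\chi(G)$, the graph $G$ contains the complete bipartite graph $K_{\ell,\chi(G)-\ell}$ as an odd minor.
   Context: All graphs are finite and simple; $\chi(G)$ is the chromatic number and $\alpha(G)$ the independence number (maximum size of a set of pairwise nonadjacent vertices). For a graph $H$ with vertex set $\{v_1,\dots,v_h\}$, an $H$-model in $G$ is a collection $(T_v)_{v\in V(H)}$ of pairwise vertex-disjoint subgraphs of $G$, each a tree (called branch sets), such that for every edge $uv\in E(H)$ there is at least one edge of $G$ between a vertex of $T_u$ and a vertex of $T_v$. An $H$-model is odd if there is a $2$-colouring (colours $1,2$) of the vertices of $\bigcup_{v} V(T_v)$ such that every edge of each tree $T_v$ has endpoints of different colours, and, for each edge $uv\in E(H)$, every edge of $G$ joining $T_u$ and $T_v$ that is used for this purpose has endpoints of the same colour (equivalently, for each $uv\in E(H)$ there is at least one edge between $T_u$ and $T_v$ whose endpoints have the same colour). $G$ contains $H$ as an odd minor if $G$ has an odd $H$-model. *)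

(* Defs.v *)
(** Finite simple graphs, chromatic and independence numbers, and odd minors
    (MathComp). *)
From mathcomp Require Import all_boot.

Set Implicit Arguments.
Unset Strict Implicit.
Unset Printing Implicit Defensive.

Record sgraph := SGraph {
  vert :> finType;
  adj : rel vert;
  adj_sym : symmetric adj;
  adj_irr : irreflexive adj }.

Definition stable (G : sgraph) (A : {set G}) : bool :=
  [forall x in A, forall y in A, ~~ adj x y].

Definition independence_number (G : sgraph) : nat :=
  \max_(A : {set G} | stable A) #|A|.

Definition colorable (G : sgraph) (k : nat) : bool :=
  [exists f : {ffun G -> 'I_k},
     [forall x, forall y, adj x y ==> (f x != f y)]].

Lemma colorable_ex (G : sgraph) : exists k, colorable G k.
Proof.
exists #|G|; apply/existsP; exists [ffun x => enum_rank x].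
apply/forallP => x; apply/forallP => y; apply/implyP => xy.
rewrite !ffunE (inj_eq enum_rank_inj).
by apply: contraTneq xy => ->; rewrite adj_irr.
Qed.

Definition chromatic_number (G : sgraph) : nat := ex_minn (colorable_ex G).

Definition bip_adj (m n : nat) : rel ('I_m + 'I_n) :=
  fun u v => match u, v with
             | inl _, inr _ | inr _, inl _ => true
             | _, _ => false
             end.

Lemma bip_adj_sym (m n : nat) : symmetric (@bip_adj m n).
Proof. by case=> ? [] ?. Qed.

Lemma bip_adj_irr (m n : nat) : irreflexive (@bip_adj m n).
Proof. by case. Qed.

Definition complete_bipartite (m n : nat) : sgraph :=
  SGraph (@bip_adj_sym m n) (@bip_adj_irr m n).

(** A subgraph need not be induced: it has its own edge relation. *)
Record subgraph (G : sgraph) := Subgraph {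
  sverts : {set G};
  sadj : rel G;
  sadj_sym : symmetric sadj;
  sadj_sub : subrel sadj (@adj G);
  sadj_verts : forall x y, sadj x y -> (x \in sverts) && (y \in sverts) }.

Definition connected_subgraph (G : sgraph) (S : subgraph G) : Prop :=
  sverts S != set0 /\ {in sverts S &, forall x y, connect (sadj S) x y}.

(** The bound on [size p] is needed because [ucycle] holds of [[:: x; y]] for
    every edge xy (and of [[::]]). *)
Definition acyclic_subgraph (G : sgraph) (S : subgraph G) : Prop :=
  forall p : seq G, ucycle (sadj S) p -> size p < 3.

Definition is_tree (G : sgraph) (S : subgraph G) : Prop :=
  connected_subgraph S /\ acyclic_subgraph S.

Record model (H G : sgraph) := Model {
  branch :> H -> subgraph G;
  branch_tree : forall u, is_tree (branch u);
  branch_disjoint :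
    forall u v, u != v -> [disjoint sverts (branch u) & sverts (branch v)];
  branch_edge : forall u v, adj u v ->
    exists x y, [/\ x \in sverts (branch u), y \in sverts (branch v) & adj x y] }.

(** The 2-colouring [c] is total on [G], but only its values on the branch
    sets matter. *)
Definition odd_model (H G : sgraph) (M : model H G) : Prop :=
  exists c : G -> bool,
    (forall u x y, sadj (M u) x y -> c x != c y) /\
    (forall u v, adj u v ->
       exists x y, [/\ x \in sverts (M u), y \in sverts (M v), adj x y
                     & c x = c y]).

Definition odd_minor (H G : sgraph) : Prop :=
  exists M : model H G, odd_model M.

(* Main.v *)
Require Import Defs.
From mathcomp Require Import all_boot zify.

Set Implicit Arguments.
Unset Strict Implicit.
Unset Printing Implicit Defensive.

(** Call a 3-set inducing a path x - w - y of G a cherry, and colour its ends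
    [true] and its middle [false]. Since alpha(G) <= 2, every vertex off the
    cherry is adjacent to x or to y, so disjoint cherries and single vertices
    coloured [true] are joined by monochromatic edges for free, except between
    two single vertices. It therefore suffices to find disjoint cherries together
    with sets A, B of further vertices, complete to each other.

    The chromatic number is the cover number of G by vertices and non-edges, so
    in a critical situation every vertex is missed by a maximum matching of the
    complement. By Gallai's lemma, either G is a join, where the two parts are
    treated separately, or |G| >= 2k - 1 for k the chromatic number. In the latter case, let
    a <= b be the sides, a + b = k, and take a maximum packing of cherries.
    - If it has at least a cherries and a < b, then a of them and any b other
      vertices will do.
    - If it has fewer than a, the vertices left over form two cliques C1, C2
      without edges between them, and every vertex is complete to C1 or to C2.
      Breaking up some cherries and adding to C1 (or C2) their vertices complete
      to it gives enough single vertices, by counting on both sides.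
    - If a = b and there are at least a - 1, choose a packing of a - 1 cherries
      and a vertex v outside of it with fewest non-neighbours in the rest.
      With at most one of them, v and a of its neighbours complete the model.
      With more, every exchange between a cherry and the rest is so constrained
      that the non-neighbours of v (a clique) contain a vertices
      having together at most 2a - 1 non-neighbours. *)

Lemma subset_of_card (T : finType) (A : {set T}) n :
  n <= #|A| -> exists2 B : {set T}, B \subset A & #|B| = n.
Proof.
case/card_geqP=> s [us <- sA]; exists [set x in s].
  by apply/subsetP=> x; rewrite inE; apply: sA.
by rewrite cardsE; apply/card_uniqP.
Qed.

(** * Cherries, their packings, and the configurations to be found *)

Section Cherries.

Variable G : sgraph.
Implicit Types (x y z w : G) (A B S U Q : {set G}) (P : {set {set G}}).

Definition coadj : rel G := fun x y => (x != y) && ~~ adj x y.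

Lemma coadj_sym : symmetric coadj.
Proof. by move=> x y; rewrite /coadj eq_sym adj_sym. Qed.

Lemma coadj_irr x : coadj x x = false.
Proof. by rewrite /coadj eqxx. Qed.

Lemma coadj_neq x y : coadj x y -> x != y.
Proof. by case/andP. Qed.

Lemma coadjN x y : coadj x y -> adj x y = false.
Proof. by case/andP=> _ /negbTE. Qed.

Lemma adj_neq x y : adj x y -> x != y.
Proof. by apply: contraTneq => ->; rewrite adj_irr. Qed.

Lemma Ncoadj x y : x != y -> ~~ coadj x y -> adj x y.
Proof. by rewrite /coadj => -> /=; rewrite negbK. Qed.

Lemma adjN x y : adj x y -> coadj x y = false.
Proof. by move=> xy; rewrite /coadj xy andbF. Qed.

Definition cherry Q : bool :=
  [exists x, exists y, exists w,
    [&& Q == [set x; y; w], coadj x y, adj w x & adj w y]].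

Lemma cherryP Q :
  reflect (exists x y w, [/\ Q = [set x; y; w], coadj x y, adj w x & adj w y])
          (cherry Q).
Proof.
apply: (iffP existsP) => [[x /existsP[y /existsP[w]]]|[x [y [w [-> xy wx wy]]]]].
  by case/and4P=> /eqP-> *; exists x, y, w.
by exists x; apply/existsP; exists y; apply/existsP; exists w; rewrite eqxx xy wx.
Qed.

Lemma cherry3 x y w : coadj x y -> adj w x -> adj w y -> cherry [set x; y; w].
Proof. by move=> *; apply/cherryP; exists x, y, w. Qed.

Lemma card_set3 x y w : x != y -> w != x -> w != y -> #|[set x; y; w]| = 3.
Proof.
move=> xy wx wy; rewrite setUC cardsU1 cards2 xy !inE.
by rewrite (negbTE wx) (negbTE wy).
Qed.

Lemma card_cherry Q : cherry Q -> #|Q| = 3.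
Proof.
case/cherryP=> x [y [w [-> xy wx wy]]].
by apply: card_set3; rewrite ?(coadj_neq xy) ?(adj_neq wx) ?(adj_neq wy).
Qed.

Definition packing U P : bool :=
  [&& trivIset P, cover P \subset U & [forall Q in P, cherry Q]].

Lemma packingP U P :
  reflect [/\ trivIset P, cover P \subset U & {in P, forall Q, cherry Q}]
          (packing U P).
Proof.
by apply: (iffP and3P) => -[-> -> /forall_inP].
Qed.

Lemma packing0 U : packing U set0.
Proof.
apply/packingP; split; last by move=> Q; rewrite inE.
  by apply/trivIsetP=> ? ?; rewrite inE.
by rewrite /cover big_set0 sub0set.
Qed.

Lemma packing_sub U U' P : U \subset U' -> packing U P -> packing U' P.
Proof. by move=> UU' /packingP[? s ?]; apply/packingP; split=> //; apply: subset_trans UU'. Qed.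

Lemma cover_sub (P P' : {set {set G}}) : P' \subset P -> cover P' \subset cover P.
Proof.
by move=> s; apply/bigcupsP=> Q QP; apply: bigcup_sup; apply: (subsetP s).
Qed.

Lemma packing_subset U P P' : P' \subset P -> packing U P -> packing U P'.
Proof.
move=> s /packingP[tP cP chP]; apply/packingP; split.
- exact: trivIsetS tP.
- exact: subset_trans (cover_sub s) cP.
- by move=> Q /(subsetP s)/chP.
Qed.

Lemma packing_disjoint U P Q Q' x :
  packing U P -> Q \in P -> Q' \in P -> x \in Q -> x \in Q' -> Q = Q'.
Proof.
case/packingP=> /trivIsetP tP _ _ QP QP' xQ xQ'; apply/eqP/negPn/negP => QQ'.
by have /pred0P/(_ x) := tP _ _ QP QP' QQ'; rewrite /= xQ xQ'.
Qed.

Lemma card_cover_packing U P : packing U P -> #|cover P| = 3 * #|P|.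
Proof.
case/packingP=> /eqP<- _ chP.
rewrite (eq_bigr (fun=> 3)) ?sum_nat_const 1?mulnC // => Q QP.
exact: card_cherry (chP Q QP).
Qed.

(** The form in which [independence_number G <= 2] is used: the complement of [G] has no
    triangle. *)
Definition coK3_free : Prop :=
  forall x y z, coadj x y -> coadj y z -> coadj x z -> False.

Lemma independence_coK3_free : independence_number G <= 2 -> coK3_free.
Proof.
move=> alphaG x y z xy yz xz.
have sT : stable [set x; y; z].
  case/andP: xy => _ xy; case/andP: yz => _ yz; case/andP: xz => _ xz.
  apply/forall_inP=> u uT; apply/forall_inP=> v vT; move: uT vT; rewrite !inE.
  by move=> /orP[/orP[]|] /eqP-> /orP[/orP[]|] /eqP->;
     rewrite ?adj_irr // adj_sym.
have := leq_bigmax_cond (F := fun A : {set G} => #|A|) _ sT.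
rewrite -/(independence_number G) card_set3 ?(coadj_neq xy) //; last 2 first.
- by rewrite eq_sym (coadj_neq xz).
- by rewrite eq_sym (coadj_neq yz).
by move=> /leq_trans/(_ alphaG).
Qed.

(* [A] and [B] are sets of singleton branch sets of the two sides; the members of
   [P] are further branch sets, available to either side. *)
Definition admissible U a b : Prop :=
  exists A B P,
    [/\ packing (U :\: (A :|: B)) P, A \subset U, B \subset U
      & {in A & B, forall x y, adj x y}]
    /\ [/\ #|A| <= a, #|B| <= b & a + b <= #|A| + #|B| + #|P|].

End Cherries.

(** * Branch sets as induced trees *)

Section InducedTrees.

Variable G : sgraph.
Implicit Types (x y z w : G) (Q T : {set G}).

Definition induced_adj T : rel G := fun x y => [&& x \in T, y \in T & adj x y].

Lemma induced_adj_sym T : symmetric (induced_adj T).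
Proof. by move=> x y; rewrite /induced_adj adj_sym andbCA. Qed.

Lemma induced_adj_sub T : subrel (induced_adj T) (@adj G).
Proof. by move=> x y /and3P[]. Qed.

Lemma induced_adj_verts T x y : induced_adj T x y -> (x \in T) && (y \in T).
Proof. by case/and3P=> -> ->. Qed.

Definition induced T : subgraph G :=
  Subgraph (@induced_adj_sym T) (@induced_adj_sub T) (@induced_adj_verts T).

Lemma induced_tree1 x : is_tree (induced [set x]).
Proof.
split.
  split; first by apply/set0Pn; exists x; rewrite /= set11.
  by move=> y z /set1P-> /set1P->; apply: connect0.
case=> [|y [|z [|u p]]] //= /andP[].
by case/andP=> /and3P[/set1P-> /set1P->]; rewrite adj_irr.
Qed.

(** A cycle on at least three distinct vertices would run through all of [Q]. On three vertices any
    two are consecutive, so the ends of the cherry would be adjacent. *)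
Lemma induced_tree_cherry Q : cherry Q -> is_tree (induced Q).
Proof.
move=> chQ; have cQ := card_cherry chQ.
case/cherryP: chQ => x [y [w [defQ xy wx wy]]].
have [xQ yQ wQ] : [/\ x \in Q, y \in Q & w \in Q].
  by rewrite defQ !inE !eqxx !orbT.
have indx : induced_adj Q w x by rewrite /induced_adj wQ xQ.
have indy : induced_adj Q w y by rewrite /induced_adj wQ yQ.
split.
  split; first by apply/set0Pn; exists x.
  have csym := sym_connect_sym (@induced_adj_sym Q).
  have wc z : z \in Q -> connect (induced_adj Q) w z.
    rewrite {1}defQ !inE => /orP[/orP[]|] /eqP->; first exact: connect1.
      exact: connect1.
    exact: connect0.
  move=> u v /= uQ vQ; apply: connect_trans (wc v vQ).
  by rewrite csym; apply: wc.
move=> p /andP[cp up]; rewrite ltnNge; apply/negP=> sp.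
have pQ : {subset p <= Q}.
  by move=> u up'; have /and3P[] := next_cycle cp up'.
have sp3 : size p = 3.
  apply/eqP; rewrite eqn_leq sp andbT -cQ -(card_uniqP up).
  by apply: subset_leq_card; apply/subsetP.
have eqp : p =i Q.
  apply/subset_cardP; first by rewrite (card_uniqP up) cQ.
  by apply/subsetP.
have xp : x \in p by rewrite eqp.
have yp : y \in p by rewrite eqp.
case: p sp3 cp up xp yp {sp pQ eqp} => [|a [|b [|c [|]]]] //= _.
case/and4P=> /and3P[_ _ ab] /and3P[_ _ bc] /and3P[_ _ ca] _ _.
move: (coadj_neq xy) (coadjN xy); rewrite !inE.
by move=> nxy n1 /or3P[] /eqP ? /or3P[] /eqP ?; subst;
  rewrite ?eqxx // in nxy;
  rewrite ?ab ?bc ?ca ?(adj_sym a c) ?(adj_sym b a) ?(adj_sym c b) ?ab ?bc ?ca in n1.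
Qed.

End InducedTrees.

(** * The 2-colouring given by a packing *)

Section OddModel.

Variable G : sgraph.
Hypothesis coK3 : coK3_free G.
Variable P : {set {set G}}.
Hypothesis packP : packing setT P.
Implicit Types (x y z w : G) (Q T : {set G}).

(* The 2-colouring: only the middle vertices of the cherries get [false]. *)
Definition ends x : bool :=
  [forall Q in P, (x \in Q) ==> [exists z in Q, coadj x z]].

Lemma ends_out x : x \notin cover P -> ends x.
Proof.
move=> xP; apply/forall_inP=> Q QP; apply/implyP=> xQ.
by case/bigcupP: xP; exists Q.
Qed.

Lemma ends_in Q x : Q \in P -> x \in Q -> ends x = [exists z in Q, coadj x z].
Proof.
move=> QP xQ; apply/forall_inP/idP => [/(_ Q QP)/implyP|e Q' Q'P]; first exact.
by apply/implyP=> xQ'; rewrite -(packing_disjoint packP QP Q'P xQ xQ').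
Qed.

Lemma ends_cherry Q : Q \in P ->
  exists x y, [/\ x \in Q, y \in Q, coadj x y & ends x /\ ends y].
Proof.
move=> QP; have [_ _ /(_ Q QP)/cherryP[x [y [w [defQ xy wx wy]]]]] := packingP _ _ packP.
have xQ : x \in Q by rewrite defQ !inE eqxx.
have yQ : y \in Q by rewrite defQ !inE eqxx orbT.
exists x, y; split=> //; split; rewrite (ends_in QP) //; apply/exists_inP.
  by exists y.
by exists x => //; rewrite coadj_sym.
Qed.

(** The ends of the cherry are not adjacent, so a vertex missing both would close a triangle of the
    complement. The edge found is monochromatic whenever [z] is coloured [true]. *)
Lemma cherry_dominates Q z : Q \in P -> z \notin Q ->
  exists x, [/\ x \in Q, ends x & adj z x].
Proof.
move=> QP zQ; have [x [y [xQ yQ xy [ex ey]]]] := ends_cherry QP.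
have zx : z != x by apply: contraNneq zQ => ->.
have zy : z != y by apply: contraNneq zQ => ->.
have [azx|nzx] := boolP (adj z x); first by exists x.
exists y; split=> //; apply: Ncoadj => //; apply/negP=> czy.
apply: (coK3 _ xy czy); by rewrite /coadj zx nzx.
Qed.

(** Every edge inside [Q] contains the middle vertex, the only one without a non-neighbour in
    [Q]. *)
Lemma ends_proper Q x y : Q \in P -> x \in Q -> y \in Q -> adj x y ->
  ends x != ends y.
Proof.
move=> QP xQ yQ; rewrite (ends_in QP xQ) (ends_in QP yQ).
have [_ _ /(_ Q QP)/cherryP[u [v [w [defQ uv wu wv]]]]] := packingP _ _ packP.
have uQ : u \in Q by rewrite defQ !inE eqxx.
have vQ : v \in Q by rewrite defQ !inE eqxx orbT.
have eu : [exists z in Q, coadj u z] by apply/exists_inP; exists v.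
have ev : [exists z in Q, coadj v z].
  by apply/exists_inP; exists u => //; rewrite coadj_sym.
have ew : [exists z in Q, coadj w z] = false.
  apply/exists_inP=> -[z]; rewrite defQ !inE => /orP[/orP[]|] /eqP->.
  - by rewrite (adjN wu).
  - by rewrite (adjN wv).
  by rewrite coadj_irr.
move: xQ yQ; rewrite defQ !inE -defQ.
by move=> /orP[/orP[]|] /eqP-> /orP[/orP[]|] /eqP->;
  rewrite ?eu ?ev ?ew // ?adj_irr // ?(coadjN uv) // adj_sym (coadjN uv).
Qed.

End OddModel.

(** * From single vertices and cherries to an odd model *)

Section AdmissibleOddMinor.

Variable G : sgraph.
Hypothesis coK3 : coK3_free G.

(** The length of [sA] is exactly [a] because the branch set of [inr j] is read off at position
    [a + j] of [sA ++ sB]; surplus entries of [sB] are ignored. *)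
Lemma odd_minor_seq a b (P : {set {set G}}) (sA sB : seq {set G}) :
    packing setT P -> size sA = a -> b <= size sB -> uniq (sA ++ sB) ->
    {in sA ++ sB, forall T : {set G}, T \in P \/ exists x, [/\ T = [set x] & x \notin cover P]} ->
    {in sA & sB, forall T T' : {set G}, exists x y,
       [/\ x \in T, y \in T', adj x y & ends P x /\ ends P y]} ->
  odd_minor (complete_bipartite a b) G.
Proof.
move=> packP sizeA sizeB uAB typAB adjAB.
pose idx (u : 'I_a + 'I_b) : nat :=
  match u with inl i => i | inr j => a + j end.
pose T u := nth set0 (sA ++ sB) (idx u).
have idx_lt u : idx u < size (sA ++ sB).
  by rewrite size_cat sizeA; case: u => i /=; have := ltn_ord i; lia.
have T_mem u : T u \in sA ++ sB by apply: mem_nth.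
have idx_inj : injective idx.
  move=> [i|i] [j|j] /= eij; first by congr inl; apply: val_inj.
  - by have := ltn_ord i; lia.
  - by have := ltn_ord j; lia.
  - by congr inr; apply: val_inj => /=; lia.
have T_l i : T (inl i) \in sA.
  by rewrite /T /= nth_cat sizeA ltn_ord mem_nth ?sizeA.
have T_r j : T (inr j) \in sB.
  rewrite /T /= nth_cat sizeA ltnNge leq_addr /= addKn mem_nth //.
  exact: leq_trans (ltn_ord j) sizeB.
have disjT u v : u != v -> [disjoint T u & T v].
  move=> uv; have nT : T u != T v by rewrite nth_uniq // (inj_eq idx_inj).
  apply/pred0P=> z /=; apply/negP=> /andP[zu zv]; case/eqP: nT.
  have [Pu|[x [Tx xP]]] := typAB _ (T_mem u); have [Pv|[y [Ty yP]]] := typAB _ (T_mem v).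
  - exact: packing_disjoint packP Pu Pv zu zv.
  - by case/bigcupP: yP; exists (T u) => //; move: zv; rewrite Ty => /set1P<-.
  - by case/bigcupP: xP; exists (T v) => //; move: zu; rewrite Tx => /set1P<-.
  - by move: zu zv; rewrite Tx Ty => /set1P-> /set1P->.
have treeT u : is_tree (induced (T u)).
  have [Pu|[x [-> _]]] := typAB _ (T_mem u); last exact: induced_tree1.
  by apply: induced_tree_cherry; have [_ _] := packingP _ _ packP; apply.
have edgeT (u v : complete_bipartite a b) : adj u v -> exists x y,
    [/\ x \in T u, y \in T v, adj x y & ends P x /\ ends P y].
  case: u v => [i|i] [j|j] // _; first by apply: adjAB.
  have [x [y [xT yT xy [ex ey]]]] := adjAB _ _ (T_l j) (T_r i).
  by exists y, x; rewrite adj_sym.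
have edge0 (u v : complete_bipartite a b) : adj u v -> exists x y,
    [/\ x \in sverts (induced (T u)), y \in sverts (induced (T v)) & adj x y].
  by case/edgeT=> x [y [? ? ? _]]; exists x, y.
exists (@Model (complete_bipartite a b) G (fun u => induced (T u)) treeT disjT edge0).
exists (ends P); split=> [u x y|u v /edgeT[x [y [? ? ? [ex ey]]]]] /=.
  case/and3P=> xT yT xy.
  have [Pu|[z [Tz _]]] := typAB _ (T_mem u).
    exact: (ends_proper packP Pu).
  by move: xT yT xy; rewrite Tz => /set1P-> /set1P->; rewrite adj_irr.
by exists x, y; rewrite ex ey.
Qed.

Lemma admissible_odd_minor a b :
  admissible [set: G] a b -> odd_minor (complete_bipartite a b) G.
Proof.
case=> A [B [P [[packP _ _ AB] [leA leB leAB]]]].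
have PAB Q x : Q \in P -> x \in Q -> x \notin A :|: B.
  move=> QP xQ; have [_ /subsetP sP _] := packingP _ _ packP.
  by have /setDP[] // : x \in [set: G] :\: (A :|: B); apply: sP; apply/bigcupP; exists Q.
have outP x : x \in A :|: B -> x \notin cover P.
  by move=> xAB; apply/bigcupP=> -[Q QP /(PAB _ _ QP)]; rewrite xAB.
have packT := packing_sub (subsetT _) packP.
(* [P1] brings the first side up to [a]; there are enough cherries because [#|B| <= b]. The other
   cherries serve the second side. *)
have [|P1 sP1 cP1] := @subset_of_card _ P (a - #|A|); first by lia.
have cP2 := cardsDS sP1.
pose single (C : {set G}) := [seq [set x] | x <- enum C].
have singleP (C T' : {set G}) : reflect (exists2 x, x \in C & T' = [set x]) (T' \in single C).
  by apply: (iffP mapP) => -[x]; rewrite ?mem_enum => xC ->; exists x; rewrite ?mem_enum.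
have uniq_single C : uniq (single C).
  by rewrite map_inj_uniq ?enum_uniq //; apply: set1_inj.
have single_notP (C T : {set G}) : T \in single C -> T \notin P.
  case/singleP=> x _ ->; apply/negP=> xP.
  have [_ _ /(_ _ xP)/card_cherry] := packingP _ _ packP.
  by rewrite cards1.
have size_single C : size (single C) = #|C| by rewrite size_map -cardE.
apply: (@odd_minor_seq _ _ P (single A ++ enum P1) (single B ++ enum (P :\: P1))) => //.
- by rewrite size_cat size_single -cardE cP1; lia.
- by rewrite size_cat size_single -cardE cP2 cP1; lia.
- rewrite !cat_uniq !uniq_single !enum_uniq !has_cat !negb_or /= !andbT.
  rewrite -andbA; apply/and4P; split.
  + by apply/hasPn=> T; rewrite mem_enum => /(subsetP sP1); apply: contraL => /single_notP.
  + apply/hasPn=> T TB; rewrite mem_cat negb_or mem_enum; apply/andP; split.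
      case/singleP: TB => x xB ->; apply/negP=> /singleP[y yA /set1_inj exy].
      by have := AB y x yA xB; rewrite exy adj_irr.
    by apply: contra (single_notP _ _ TB) => /(subsetP sP1).
  + apply/hasPn=> T; rewrite mem_enum => /setDP[TP TP1]; rewrite mem_cat negb_or mem_enum TP1 andbT.
    by apply: contraL TP => /single_notP.
  + apply/hasPn=> T; rewrite mem_enum => /setDP[TP _].
    by apply: contraL TP => /single_notP.
- move=> T; rewrite !mem_cat !mem_enum => /orP[]/orP[].
  + by case/singleP=> x xA ->; right; exists x; rewrite outP // inE xA.
  + by move/(subsetP sP1); left.
  + by case/singleP=> x xB ->; right; exists x; rewrite outP // inE xB orbT.
  + by case/setDP; left.
move=> T T'; rewrite !mem_cat !mem_enum => /orP[/singleP[x xA ->]|TP] /orP[/singleP[y yB ->]|T'P].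
- exists x, y; rewrite !set11 AB //; split=> //.
  by split; apply: ends_out; rewrite outP // inE ?xA ?yB ?orbT.
- case/setDP: T'P => T'P _.
  have [|y [yT' ey xy]] := cherry_dominates coK3 packT (z := x) T'P.
    by apply/negP=> /(PAB _ _ T'P); rewrite inE xA.
  exists x, y; rewrite set11; split=> //; split=> //.
  by apply: ends_out; rewrite outP // inE xA.
- have {}TP := subsetP sP1 _ TP.
  have [|x [xT ex yx]] := cherry_dominates coK3 packT (z := y) TP.
    by apply/negP=> /(PAB _ _ TP); rewrite inE yB orbT.
  exists x, y; rewrite set11 adj_sym; split=> //; split=> //.
  by apply: ends_out; rewrite outP // inE yB orbT.
case/setDP: T'P => T'P T'P1.
have {}TP' := subsetP sP1 _ TP.
have [x [_ [xT _ _ [ex _]]]] := ends_cherry packT TP'.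
have [|y [yT' ey xy]] := cherry_dominates coK3 packT (z := x) T'P.
  apply/negP=> xT'; case/negP: T'P1.
  by rewrite (packing_disjoint packT T'P TP' xT' xT).
by exists x, y.
Qed.

End AdmissibleOddMinor.

(** * Operations on admissible configurations *)

Section Admissible.

Variable G : sgraph.
Implicit Types (x y z w : G) (A B S M U Q : {set G}) (P : {set {set G}}).

Lemma packing_in U P Q x : packing U P -> Q \in P -> x \in Q -> x \in U.
Proof.
case/packingP=> _ /subsetP sP _ QP xQ.
by apply: sP; apply/bigcupP; exists Q.
Qed.

Lemma packingU U1 U2 P1 P2 : [disjoint U1 & U2] ->
    packing U1 P1 -> packing U2 P2 ->
  packing (U1 :|: U2) (P1 :|: P2) /\ #|P1 :|: P2| = #|P1| + #|P2|.
Proof.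
move=> dU pk1 pk2.
have meet Q1 Q2 x : Q1 \in P1 -> Q2 \in P2 -> x \in Q1 -> x \in Q2 -> False.
  move=> QP1 QP2 x1 x2; have /pred0P/(_ x) := dU; rewrite /=.
  by rewrite (packing_in pk1 QP1 x1) (packing_in pk2 QP2 x2).
have [t1 c1 ch1] := packingP _ _ pk1; have [t2 c2 ch2] := packingP _ _ pk2.
split; last first.
  rewrite cardsU [P1 :&: P2](_ : _ = set0) ?cards0 ?subn0 //.
  apply/setP=> Q; rewrite !inE; apply/negP=> /andP[QP1 QP2].
  have /card_gt0P[x xQ] : 0 < #|Q| by rewrite card_cherry ?ch1.
  exact: (meet Q Q x).
apply/packingP; split.
- apply/trivIsetP=> Q Q'; rewrite !inE => QP Q'P QQ'.
  apply/pred0P=> x /=; apply/negP=> /andP[xQ xQ'].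
  case/orP: QP => QP; case/orP: Q'P => Q'P.
  + by case/eqP: QQ'; apply: packing_disjoint pk1 QP Q'P xQ xQ'.
  + exact: meet QP Q'P xQ xQ'.
  + exact: meet Q'P QP xQ' xQ.
  + by case/eqP: QQ'; apply: packing_disjoint pk2 QP Q'P xQ xQ'.
- apply/bigcupsP=> Q; rewrite inE => /orP[] QP; apply/subsetP=> x xQ; rewrite inE.
    by rewrite (packing_in pk1 QP xQ).
  by rewrite (packing_in pk2 QP xQ) orbT.
by move=> Q; rewrite inE => /orP[/ch1|/ch2].
Qed.

Lemma packing1 U Q : Q \subset U -> cherry Q -> packing U [set Q].
Proof.
move=> sQ chQ; apply/packingP; split.
- exact: trivIset1.
- by rewrite /cover big_set1.
- by move=> Q' /set1P->.
Qed.

Lemma admissible_sym U a b : admissible U a b -> admissible U b a.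
Proof.
case=> A [B [P [[pk sA sB AB] [cA cB cAB]]]]; exists B, A, P.
split; split; rewrite // 1?setUC //; last by lia.
by move=> x y xB yA; rewrite adj_sym AB.
Qed.

Lemma admissible_sub U U' a b : U \subset U' -> admissible U a b -> admissible U' a b.
Proof.
move=> sU [A [B [P [[pk sA sB AB] [cA cB cAB]]]]]; exists A, B, P.
split; split; rewrite //; try exact: subset_trans sU.
by apply: packing_sub pk; apply: setSD.
Qed.

(** Single vertices of opposite sides either come from the same part, where they are adjacent
    already, or from different parts, between which all edges are present. *)
Lemma admissible_join U1 U2 a1 b1 a2 b2 :
    {in U1 & U2, forall x y, adj x y} ->
    admissible U1 a1 b1 -> admissible U2 a2 b2 ->
  admissible (U1 :|: U2) (a1 + a2) (b1 + b2).
Proof.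
move=> U12 [A1 [B1 [P1 [[pk1 sA1 sB1 AB1] [cA1 cB1 cAB1]]]]].
case=> A2 [B2 [P2 [[pk2 sA2 sB2 AB2] [cA2 cB2 cAB2]]]].
have dU : [disjoint U1 & U2].
  apply/pred0P=> x /=; apply/negP=> /andP[x1 x2].
  by have := U12 x x x1 x2; rewrite adj_irr.
have dS (C1 C2 : {set G}) : C1 \subset U1 -> C2 \subset U2 -> [disjoint C1 & C2].
  by move=> s1 s2; exact: (disjointW s1 s2 dU).
have cU (C1 C2 : {set G}) : C1 \subset U1 -> C2 \subset U2 -> #|C1 :|: C2| = #|C1| + #|C2|.
  by move=> s1 s2; rewrite cardsU disjoint_setI0 ?dS // cards0 subn0.
have [|pk cP] := packingU _ pk1 pk2; first by apply: dS; apply: subsetDl.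
exists (A1 :|: A2), (B1 :|: B2), (P1 :|: P2); split; split.
- apply: packing_sub pk; apply/subsetP=> x; rewrite !inE.
  have /pred0P/(_ x) /= := dU.
  have /implyP := subsetP sA1 x; have /implyP := subsetP sA2 x.
  have /implyP := subsetP sB1 x; have /implyP := subsetP sB2 x.
  by do !case: (_ \in _).
- exact: setUSS.
- exact: setUSS.
- move=> x y; rewrite !inE => /orP[x1|x2] /orP[y1|y2]; first exact: AB1.
  + by apply: U12; [apply: (subsetP sA1)|apply: (subsetP sB2)].
  + by rewrite adj_sym; apply: U12; [apply: (subsetP sB1)|apply: (subsetP sA2)].
  + exact: AB2.
- by rewrite cU //; lia.
- by rewrite cU //; lia.
- by rewrite !cU // cP; lia.
Qed.

(* [M] goes to the side of size [b], the vertices of [S :\: M] to either side. *)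
Lemma admissible_fill U P S M a b :
    packing (U :\: S) P -> S \subset U -> M \subset S ->
    {in S :\: M & S, forall x y, x != y -> adj x y} ->
    #|M| <= b -> a + b <= #|P| + #|S| ->
  admissible U a b.
Proof.
move=> pk sS sM SM cM cS; have cSM := cardsDS sM; have leMS := subset_leq_card sM.
(* If [S :\: M] has fewer than [a] vertices, then [A] is all of it, and the remaining set [M] fits
   into [B] since [#|M| <= b]. In every case [A] and [B] exhaust [S] or have [a + b] vertices
   together. *)
have [|A sA cA] := @subset_of_card _ (S :\: M) (minn a #|S :\: M|); first exact: geq_minr.
have sAS : A \subset S by apply: subset_trans sA (subsetDl _ _).
have sMA : M \subset S :\: A.
  apply/subsetP=> x xM; rewrite inE (subsetP sM) // andbT.
  by apply/negP=> /(subsetP sA); rewrite inE xM.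
have cSA := cardsDS sAS.
have [|B sB cB] := @subset_of_card _ (S :\: A) (minn b #|S :\: A|); first exact: geq_minr.
have sBS : B \subset S by apply: subset_trans sB (subsetDl _ _).
exists A, B, P; split; split.
- by apply: packing_sub pk; apply: setDS; rewrite subUset sAS.
- exact: subset_trans sS.
- exact: subset_trans sS.
- move=> x y xA yB; apply: SM; [exact: (subsetP sA) | exact: (subsetP sBS) |].
  by apply: contraTneq xA => ->; have /setDP[] := subsetP sB _ yB.
- by lia.
- by lia.
- by rewrite cA cB cSA cSM cA cSM; lia.
Qed.

End Admissible.

(** * Exchange and counting in packings, and sets without cherries *)

Section Packings.

Variable G : sgraph.
Implicit Types (x y z w : G) (A B C S M U Q R X : {set G}) (P : {set {set G}}).

Definition clique C := {in C &, forall x y, x != y -> adj x y}.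

Lemma packingD U P S : packing U P -> S \subset U :\: cover P -> packing (U :\: S) P.
Proof.
case/packingP=> tP /subsetP cP ch /subsetP sS; apply/packingP; split=> //.
apply/subsetP=> x xP; rewrite inE (cP x xP) andbT; apply/negP=> /sS.
by rewrite inE xP.
Qed.

(** The basic exchange: [Q] together with the uncovered vertices is disjoint from all other cherries
    and can be repacked freely. *)
Lemma packing_replace U P Q P' :
    packing U P -> Q \in P -> packing (Q :|: (U :\: cover P)) P' ->
  packing U ((P :\ Q) :|: P') /\ #|(P :\ Q) :|: P'| = #|P|.-1 + #|P'|.
Proof.
move=> pk QP pk'.
have [tP /subsetP cP ch] := packingP _ _ pk.
have pk1 : packing (cover (P :\ Q)) (P :\ Q).
  by apply/packingP; split=> //; [exact: trivIsetS (subsetDl _ _) tP | move=> Q' /setDP[/ch]].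
have dis : [disjoint cover (P :\ Q) & Q :|: (U :\: cover P)].
  apply/pred0P=> x /=; apply/negP=> /andP[/bigcupP[Q' /setD1P[Q'Q Q'P] xQ']].
  rewrite !inE => /orP[xQ|/andP[/bigcupP[]]]; last by exists Q'.
  by case/eqP: Q'Q; apply: packing_disjoint pk Q'P QP xQ' xQ.
have [pkU ->] := packingU dis pk1 pk'; split; last by rewrite (cardsD1 Q P) QP.
apply: packing_sub pkU; rewrite subUset; apply/andP; split.
  by apply: subset_trans (cover_sub (subsetDl _ _)) _; apply/subsetP.
rewrite subUset subsetDl andbT; apply/subsetP=> x.
exact: packing_in pk QP.
Qed.

Lemma card_trivIsetI P A : trivIset P -> #|A :&: cover P| = \sum_(Q in P) #|A :&: Q|.
Proof.
move=> tP; rewrite -sum1_card.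
rewrite (eq_bigl (fun x => (x \in cover P) && (x \in A))); last first.
  by move=> x; rewrite inE andbC.
rewrite (big_trivIset_cond _ tP) /=; apply: eq_bigr => Q _.
by rewrite -sum1_card; apply: eq_bigl => x; rewrite inE andbC.
Qed.

Lemma card_packing_compl U P : packing U P -> #|U :\: cover P| + 3 * #|P| = #|U|.
Proof.
move=> pk; have [_ cP _] := packingP _ _ pk.
by have := cardsDS cP; have := subset_leq_card cP; rewrite (card_cover_packing pk); lia.
Qed.

Lemma admissible_clique U P C a b :
    packing U P -> C \subset U :\: cover P -> clique C -> a + b <= #|P| + #|C| ->
  admissible U a b.
Proof.
move=> pk sC clC cC; apply: (@admissible_fill _ U P C set0) => //.
- exact: packingD.
- exact: subset_trans sC (subsetDl _ _).
- exact: sub0set.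
- by rewrite setD0.
- by rewrite cards0.
Qed.

(** The cherries form one side and [b] uncovered vertices the other, so no adjacency among single
    vertices is asked for. *)
Lemma admissible_cherries U a b P : packing U P -> #|P| = a ->
  3 * a + b <= #|U| -> admissible U a b.
Proof.
move=> pk cP cU; have := card_packing_compl pk => cR.
have [|S sS cS] := @subset_of_card _ (U :\: cover P) b; first by lia.
apply: (@admissible_fill _ U P S S) => //.
- exact: packingD.
- exact: subset_trans sS (subsetDl _ _).
- by move=> x y; rewrite setDv inE.
- by rewrite cS.
- by rewrite cS cP.
Qed.

Hypothesis coK3 : coK3_free G.

Lemma coadj_clique x C : {in C, forall y, coadj x y} -> clique C.
Proof.
move=> xC y z yC zC yz; apply: Ncoadj => //; apply/negP=> cyz.
exact: coK3 (xC y yC) cyz (xC z zC).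
Qed.

(** Unless [R] is a clique, fix a non-edge [c1 c2] in it. A further vertex of [R] misses [c1] or
    [c2], or else it would be the middle of a cherry. The non-neighbours of one vertex form a
    clique, which gives the two cliques. *)
Lemma cherry_free_split R : (forall Q, Q \subset R -> ~~ cherry Q) ->
  exists C1 C2, [/\ R = C1 :|: C2, clique C1, clique C2
    & {in C1 & C2, forall x y, coadj x y}].
Proof.
move=> free.
have noP x y w : x \in R -> y \in R -> w \in R -> coadj x y -> adj w x -> adj w y -> False.
  move=> xR yR wR xy wx wy; have := cherry3 xy wx wy; apply/negP/free.
  by apply/subsetP=> z; rewrite !inE => /orP[/orP[]|] /eqP->.
have [/exists_inP[c1 c1R /exists_inP[c2 c2R c12]]|] :=
  boolP [exists c1 in R, exists c2 in R, coadj c1 c2]; last first.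
  move=> clR; exists R, set0; rewrite setU0; split=> //.
  - move=> x y xR yR xy; apply: Ncoadj => //; apply: contra clR => cxy.
    by apply/exists_inP; exists x => //; apply/exists_inP; exists y.
  - by move=> x y; rewrite inE.
  - by move=> x y _; rewrite inE.
pose C1 := [set r in R | coadj c2 r]; pose C2 := [set r in R | coadj c1 r].
have clC1 : clique C1 by apply: (@coadj_clique c2) => y; rewrite inE => /andP[].
have clC2 : clique C2 by apply: (@coadj_clique c1) => y; rewrite inE => /andP[].
have c1C1 : c1 \in C1 by rewrite inE c1R coadj_sym.
have c2C2 : c2 \in C2 by rewrite inE c2R.
exists C1, C2; split=> //.
- apply/setP=> r; rewrite !inE -andb_orr; have [rR|//] := boolP (r \in R).
  apply/esym; have [->|rc1] := eqVneq r c1; first by rewrite coadj_sym c12.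
  have [->|rc2] := eqVneq r c2; first by rewrite c12 orbT.
  apply/negPn/negP; rewrite negb_or => /andP[n2 n1].
  apply: (noP c1 c2 r) => //; apply: Ncoadj => //; by rewrite coadj_sym.
move=> x y xC yC; have := yC; have := xC; rewrite !inE.
move=> /andP[xR cx] /andP[yR cy].
apply/negPn/negP=> nxy; have [exy|xy] := eqVneq x y.
  by apply: (coK3 cy _ c12); rewrite -exy coadj_sym.
(* An edge between the cliques makes [x] the middle of a cherry with ends [c1] and [y]. *)
have axy := Ncoadj xy nxy.
have [ex|xc1] := eqVneq x c1; first by rewrite ex cy in nxy.
by apply: (noP c1 y x) => //; apply: clC1.
Qed.

End Packings.

(** * Maximum packings whose uncovered vertices form two separate cliques *)

Lemma exists_other (T : finType) (C : {set T}) x : 1 < #|C| -> exists2 y, y \in C & y != x.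
Proof.
case/card_gt1P=> [y [z [yC zC yz]]]; have [exy|] := eqVneq y x; last by exists y.
by exists z => //; rewrite eq_sym -exy.
Qed.

Section TwoCliqueRest.

Variables (G : sgraph) (coK3 : coK3_free G) (U : {set G}) (P : {set {set G}}).
Hypothesis packP : packing U P.
Hypothesis maxP : forall P', packing U P' -> #|P'| <= #|P|.
Variables C1 C2 : {set G}.
Hypothesis restE : U :\: cover P = C1 :|: C2.
Hypothesis co12 : {in C1 & C2, forall x y, coadj x y}.
Hypotheses (card1 : 1 < #|C1|) (card2 : 1 < #|C2|).
Implicit Types (x y z w u : G) (Q C : {set G}).

Definition dominators C : {set G} := [set u | [forall c in C, adj u c]].

Lemma dominatorsP C u : reflect {in C, forall c, adj u c} (u \in dominators C).
Proof. by rewrite inE; apply: forall_inP. Qed.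

(** A non-neighbour of [u] in each clique would give a triangle of the complement. *)
Lemma mixed_cases u : u \notin C1 :|: C2 -> (u \in dominators C1) || (u \in dominators C2).
Proof.
rewrite inE negb_or => /andP[u1 u2]; apply/negPn/negP; rewrite negb_or !inE.
case/andP=> /forall_inPn[c c1 uc] /forall_inPn[d d2 ud].
apply: (coK3 (x := c) (y := u) (z := d)); last exact: co12.
- by rewrite coadj_sym /coadj uc andbT; apply: contraNneq u1 => ->.
- by rewrite /coadj ud andbT; apply: contraNneq u2 => ->.
Qed.

Lemma packed_notin Q x : Q \in P -> x \in Q -> x \notin C1 :|: C2.
Proof. by move=> QP xQ; rewrite -restE inE negb_and negbK; apply/orP; left; apply/bigcupP; exists Q. Qed.

(** Two disjoint cherries made of [Q] and uncovered vertices could replace [Q], against the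
    maximality of [P]. *)
Lemma no_two_cherries Q x1 y1 w1 x2 y2 w2 :
    Q \in P -> {subset [:: x1; y1; w1; x2; y2; w2] <= Q :|: (C1 :|: C2)} ->
    uniq [:: x1; y1; w1; x2; y2; w2] ->
    coadj x1 y1 -> adj w1 x1 -> adj w1 y1 ->
    coadj x2 y2 -> adj w2 x2 -> adj w2 y2 -> False.
Proof.
move=> QP sub un xy1 wx1 wy1 xy2 wx2 wy2.
have ch1 := cherry3 xy1 wx1 wy1; have ch2 := cherry3 xy2 wx2 wy2.
set Q1 := [set x1; y1; w1] in ch1; set Q2 := [set x2; y2; w2] in ch2.
have dis : [disjoint Q1 & Q2].
  apply/pred0P=> z /=; apply/negP=> /andP[z1 z2].
  have /hasPn/(_ z) : ~~ has (in_mem^~ (mem [:: x1; y1; w1])) [:: x2; y2; w2].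
    by have := un; rewrite (cat_uniq [:: x1; y1; w1] [:: x2; y2; w2]) => /and3P[].
  rewrite !inE; move: z1 z2; rewrite !inE => z1 z2.
  by rewrite !orbA z1 z2 => /(_ isT).
have [pk2 c2] := packingU dis (packing1 (subxx Q1) ch1) (packing1 (subxx Q2) ch2).
have sub12 : Q1 :|: Q2 \subset Q :|: (U :\: cover P).
  rewrite restE; apply/subsetP=> z; rewrite !inE => zQ; have := sub z.
  by rewrite !inE !orbA; apply; rewrite -!orbA in zQ *.
have [pk3 c3] := packing_replace packP QP (packing_sub sub12 pk2).
have P_gt0 : 0 < #|P| by apply/card_gt0P; exists Q.
by have := maxP pk3; rewrite c3 c2 !cards1 addn2 (ltn_predK P_gt0) ltnn.
Qed.

(* By [mixed_cases] these are complete to [C1] when they lie outside both cliques. *)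
Definition mixed : {set G} := [set u | (u \notin dominators C2) && [exists c in C2, adj u c]].

(** Both vertices are complete to [C1] and have a neighbour in [C2], so each can be the middle of a
    cherry with one end in either clique. Every configuration of [m] and [m'] in [Q] leads to two
    disjoint cherries that can replace [Q]. *)
Lemma mixed_unique Q m m' :
  Q \in P -> m \in Q -> m' \in Q -> m \in mixed -> m' \in mixed -> m = m'.
Proof.
move=> QP mQ m'Q mM m'M; apply/eqP/negPn/negP=> mm'.
have n12 x y : x \in C1 -> y \in C2 -> (x == y) = false.
  by move=> x1 y2; apply/negbTE/coadj_neq/co12.
have n21 x y : x \in C2 -> y \in C1 -> (x == y) = false by move=> *; rewrite eq_sym n12.
have nq1 x y : x \in Q -> y \in C1 -> (x == y) = false.
  move=> xQ y1; apply/eqP=> exy; have := packed_notin QP xQ.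
  by rewrite exy inE y1.
have nq2 x y : x \in Q -> y \in C2 -> (x == y) = false.
  move=> xQ y1; apply/eqP=> exy; have := packed_notin QP xQ.
  by rewrite exy inE y1 orbT.
have n1q x y : x \in C1 -> y \in Q -> (x == y) = false by move=> *; rewrite eq_sym nq1.
have n2q x y : x \in C2 -> y \in Q -> (x == y) = false by move=> *; rewrite eq_sym nq2.
have dom1 u : u \in Q -> u \in mixed -> {in C1, forall c, adj u c}.
  move=> uQ; rewrite inE => /andP[u2 _]; apply/dominatorsP.
  by have := mixed_cases (packed_notin QP uQ); rewrite (negbTE u2) orbF.
have adm := dom1 _ mQ mM; have adm' := dom1 _ m'Q m'M.
have [[d dC md] [d' d'C m'd']] : (exists2 d, d \in C2 & adj m d) /\ (exists2 d, d \in C2 & adj m' d).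
  by move: mM m'M; rewrite !inE => /andP[_ /exists_inP ?] /andP[_ /exists_inP].
have [c [c' [cC c'C cc']]] := card_gt1P card1.
(* Otherwise the cherries [c], [m], [x] and [c'], [m'], [y] are disjoint. Hence [m] and [m'] have
   one and the same only neighbour in [C2]; any other vertex [e] of [C2] is missed by both, which
   makes [m] and [m'] adjacent. *)
have same x y : x \in C2 -> y \in C2 -> adj m x -> adj m' y -> x = y.
  move=> xC yC mx m'y; apply/eqP/negPn/negP=> xy.
  apply: (@no_two_cherries Q c x m c' y m' QP); try by [|apply: co12|apply: adm|apply: adm'].
  - by move=> z; rewrite !inE => /or4P[|||/or3P[]] /eqP->;
      rewrite ?mQ ?m'Q ?cC ?c'C ?xC ?yC ?orbT.
  - rewrite /= !inE !negb_or; repeat (apply/andP; split);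
      first [by [] | by rewrite eq_sym | by rewrite n12 | by rewrite n21 | by rewrite nq1
      | by rewrite nq2 | by rewrite n1q | by rewrite n2q].
have edd' : d = d' := same _ _ dC d'C md m'd'; subst d'.
have [e eC ed] := exists_other d card2.
have em : coadj e m.
  rewrite /coadj n2q //=; apply: contra ed => em; apply/eqP; apply: same => //.
  by rewrite adj_sym.
have em' : coadj e m'.
  rewrite /coadj n2q //=; apply: contra ed => em'; apply/eqP/esym; apply: same => //.
  by rewrite adj_sym.
have amm' : adj m m'.
  by apply: Ncoadj => //; apply/negP=> cm; apply: (coK3 em cm em').
(* In the applications [u] is the middle of [Q], [u'] its mixed end and [z] the other end. If [z] is
   complete to [C1], it is the middle of a second cherry, with an end [e]; otherwise [z] and a
   non-neighbour in [C1] are the ends of one through [u]. *)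
have last_step u u' z : u \in Q -> u' \in Q -> z \in Q -> u != u' -> z != u -> z != u' ->
    {in C1, forall c, adj u c} -> {in C1, forall c, adj u' c} ->
    adj u' d -> coadj e u' -> adj u z -> coadj z u' -> False.
  move=> uQ u'Q zQ uu' zu zu' adu adu' u'd eu' uz czu'.
  have ze : adj z e.
    apply: Ncoadj; first by rewrite nq2.
    by apply/negP=> cze; apply: (coK3 cze eu' czu').
  have [/dominatorsP zdom|] := boolP (z \in dominators C1).
    apply: (@no_two_cherries Q c e z c' d u' QP); try by [|apply: co12|apply: adu'|apply: zdom].
    - by move=> v; rewrite !inE => /or4P[|||/or3P[]] /eqP->;
      rewrite ?zQ ?u'Q ?cC ?c'C ?eC ?dC ?orbT.
    - rewrite /= !inE !negb_or; repeat (apply/andP; split);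
      first [by [] | by rewrite eq_sym | by rewrite n12 | by rewrite n21 | by rewrite nq1
      | by rewrite nq2 | by rewrite n1q | by rewrite n2q].
  rewrite inE => /forall_inPn[c0 c0C zc0].
  have [c1 c1C c10] := exists_other c0 card1.
  apply: (@no_two_cherries Q z c0 u c1 d u' QP); try by [|apply: co12|apply: adu|apply: adu'].
  - by move=> v; rewrite !inE => /or4P[|||/or3P[]] /eqP->;
      rewrite ?zQ ?u'Q ?uQ ?c0C ?c1C ?dC ?orbT.
  - rewrite /= !inE !negb_or; repeat (apply/andP; split);
      first [by [] | by rewrite eq_sym | by rewrite n12 | by rewrite n21 | by rewrite nq1
      | by rewrite nq2 | by rewrite n1q | by rewrite n2q].
  - by rewrite /coadj nq1.
have [_ _ /(_ _ QP)/cherryP[x [y [w [defQ xy wx wy]]]]] := packingP _ _ packP.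
have [xQ yQ wQ] : [/\ x \in Q, y \in Q & w \in Q].
  by rewrite defQ !inE !eqxx !orbT.
have m'm : m' != m by rewrite eq_sym.
have am'm : adj m' m by rewrite adj_sym.
have yx : coadj y x by rewrite coadj_sym.
have [nxy nwx nwy] := And3 (coadj_neq xy) (adj_neq wx) (adj_neq wy).
have [nyx nxw nyw] : [/\ y != x, x != w & y != w] by rewrite ![_ == w]eq_sym eq_sym.
move: (mQ) (m'Q); rewrite {1 2}defQ !inE.
case/orP=> [/orP[]|] /eqP em0 /orP[/orP[]|] /eqP em'0; subst m m'; rewrite ?eqxx // in mm'.
- by rewrite (coadjN xy) in amm'.
- by apply: (last_step w x y) => //.
- by rewrite (coadjN yx) in amm'.
- by apply: (last_step w y x) => //.
- by apply: (last_step w x y) => //.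
- by apply: (last_step w y x) => //.
Qed.

End TwoCliqueRest.

(** * Breaking up cherries into single vertices *)

Section Release.

Variables (G : sgraph) (coK3 : coK3_free G) (U : {set G}) (P : {set {set G}}).
Hypothesis packP : packing U P.
Implicit Types (x y z w u : G) (Q C : {set G}) (L : {set {set G}}).

Lemma release_sub L (S : {set G}) :
    L \subset P -> S \subset (U :\: cover P) :|: cover L ->
  S \subset U :\: cover (P :\: L).
Proof.
move=> /subsetP sL /subsetP sS; apply/subsetP=> x /sS.
have [_ /subsetP cP _] := packingP _ _ packP.
rewrite !inE => /orP[/andP[xP xU]|xL].
  rewrite xU andbT; apply: contra xP; apply: (subsetP (cover_sub (subsetDl _ _))).
have [Q QL xQ] := bigcupP xL.
rewrite (cP x) ?andbT; last by apply/bigcupP; exists Q => //; apply: sL.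
apply/bigcupP=> -[Q' /setDP[Q'P Q'L] xQ'].
by case/negP: Q'L; rewrite (packing_disjoint packP Q'P (sL _ QL) xQ' xQ).
Qed.

(** The vertices of the cherries in [L] become available as single vertices; the summand [#|L|] pays
    for the branch sets lost. *)
Lemma admissible_release L (S M : {set G}) a b :
    L \subset P -> S \subset (U :\: cover P) :|: cover L -> M \subset S ->
    {in S :\: M & S, forall x y, x != y -> adj x y} ->
    #|M| <= b -> a + b + #|L| <= #|P| + #|S| ->
  admissible U a b.
Proof.
move=> sL sS sM SM cM cS.
have sU := release_sub sL sS.
apply: (@admissible_fill _ U (P :\: L) S M) => //.
- by apply: packingD => //; apply: packing_subset packP; apply: subsetDl.
- exact: subset_trans sU (subsetDl _ _).
- have := cardsDS sL; have := subset_leq_card sL => le1 ->.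
  by rewrite -(leq_add2r #|L|); apply: leq_trans cS _; rewrite addnAC subnK.
Qed.

Variables C1 C2 : {set G}.
Hypothesis restE : U :\: cover P = C1 :|: C2.
Hypothesis cl1 : clique C1.
Hypothesis co12 : {in C1 & C2, forall x y, coadj x y}.

Lemma rest_disjoint L x : L \subset P -> x \in C1 -> x \notin cover L.
Proof.
move=> sL xC; apply/negP=> /(subsetP (cover_sub sL)) xP.
have : x \in U :\: cover P by rewrite restE inE xC.
by rewrite inE xP.
Qed.

Lemma covered_notin L x : L \subset P -> x \in cover L -> x \notin C1 :|: C2.
Proof.
move=> sL /bigcupP[Q QL xQ].
by apply: (packed_notin restE _ xQ); apply: (subsetP sL).
Qed.

Lemma card_rest_released L (A : {set G}) : L \subset P ->
    {in L, forall Q, 1 < #|A :&: Q|} ->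
  #|C1| + 2 * #|L| <= #|C1 :|: (A :&: cover L)|.
Proof.
move=> sL A2; rewrite cardsU [_ :&: (_ :&: _)](_ : _ = set0); last first.
  apply/setP=> x; rewrite !inE; apply/negP=> /and3P[xC _].
  by rewrite (negbTE (rest_disjoint sL xC)).
rewrite cards0 subn0 leq_add2l card_trivIsetI; last first.
  by have [+ _ _] := packingP _ _ packP; apply: trivIsetS.
by rewrite mulnC -sum_nat_const; apply: leq_sum.
Qed.

(* Released vertices complete to [C1] need not be adjacent to each other, so all of
   them go to one side, which costs two vertices of that side per cherry. *)
Lemma admissible_loose L a b :
    L \subset P -> {in L, forall Q, 1 < #|dominators C1 :&: Q|} ->
    2 * #|L| <= b -> a + b <= #|P| + #|C1| + #|L| ->
  admissible U a b.
Proof.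
move=> sL dom2 cb cab.
have cC : 2 * #|L| <= #|dominators C1 :&: cover L|.
  rewrite card_trivIsetI; last by have [+ _ _] := packingP _ _ packP; apply: trivIsetS.
  by rewrite mulnC -sum_nat_const; apply: leq_sum.
(* A cherry may have three vertices complete to [C1]; only [2 * #|L|] in all are kept, so that they
   fit on one side. *)
have [M /subsetP sM cM] := subset_of_card cC.
have disj : C1 :&: M = set0.
  apply/setP=> x; rewrite !inE; apply/negP=> /andP[xC /sM].
  by rewrite inE (negbTE (rest_disjoint sL xC)) andbF.
apply: (@admissible_release L (C1 :|: M) M) => //.
- rewrite restE; apply/subsetP=> x; rewrite !inE => /orP[->//|/sM].
  by rewrite inE => /andP[_ ->]; rewrite orbT.
- exact: subsetUr.
- move=> x y; rewrite !inE => /andP[/negbTE-> /=]; rewrite orbF => xC.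
  case/orP=> [yC|/sM]; first exact: cl1.
  by rewrite inE => /andP[/dominatorsP/(_ _ xC)]; rewrite adj_sym.
- by rewrite cM.
- by rewrite cardsU disj cards0 subn0 cM; lia.
Qed.

Hypothesis maxP : forall P', packing U P' -> #|P'| <= #|P|.
Hypotheses (card1 : 1 < #|C1|) (card2 : 1 < #|C2|).

(* Two released vertices with a common non-neighbour in [C2] are adjacent, so only
   the mixed ones, at most one per cherry, are confined to one side. *)
Lemma admissible_strict L a b :
    L \subset P -> {in L, forall Q, 1 < #|~: dominators C2 :&: Q|} ->
    #|L| <= b -> a + b <= #|P| + #|C1| + #|L| ->
  admissible U a b.
Proof.
move=> sL dom2 cb cab; set Y := ~: dominators C2 in dom2 *.
pose S := C1 :|: (Y :&: cover L).
have tL : trivIset L by have [+ _ _] := packingP _ _ packP; apply: trivIsetS.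
have cS : #|C1| + 2 * #|L| <= #|S| by apply: card_rest_released.
pose M := (Y :&: mixed C2) :&: cover L.
have Ydom u : u \in Y -> u \in cover L -> {in C1, forall c, adj u c}.
  move=> uY /(covered_notin sL)/(mixed_cases coK3 co12); move: uY.
  by rewrite inE => /negbTE->; rewrite orbF => /dominatorsP.
apply: (@admissible_release L S M) => //.
- rewrite restE; apply/subsetP=> x; rewrite !inE => /orP[->//|/andP[_ ->]].
  by rewrite orbT.
- by apply/subsetP=> x; rewrite !inE => /andP[/andP[-> _] ->]; rewrite orbT.
- move=> x y /setDP[xS xM] yS xy.
  case/setUP: xS => [xC|/setIP[xY xP]]; case/setUP: yS => [yC|/setIP[yY yP]].
  + exact: cl1.
  + by rewrite adj_sym; apply: Ydom.
  + exact: Ydom.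
  + have : y \notin dominators C2 by rewrite -in_setC.
    rewrite inE => /forall_inPn[c cC yc].
    have nC z : z \in cover L -> z != c.
      move=> zP; apply: contraTneq zP => ->; apply/negP=> /(covered_notin sL).
      by rewrite inE cC orbT.
    (* As [x] is neither mixed nor complete to [C2], it has no neighbour in [C2]; so [c] is missed
       by both [x] and [y]. *)
    apply: Ncoadj => //; apply/negP=> cxy.
    apply: (coK3 (x := x) (y := y) (z := c)) => //; rewrite /coadj nC //=.
    have xD : x \notin dominators C2 by rewrite -in_setC.
    have : x \notin mixed C2.
      by apply: contra xM => xm; apply/setIP; split=> //; apply/setIP.
    by rewrite inE xD /= => /exists_inPn; apply.
- rewrite (card_trivIsetI _ tL); apply: leq_trans cb; rewrite -sum1_card.
  apply: leq_sum => Q QL; apply/card_le1_eqP => m m'.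
  move=> /setIP[/setIP[_ mM] mQ] /setIP[/setIP[_ m'M] m'Q].
  apply: (mixed_unique coK3 packP maxP restE co12 card1 card2 (Q := Q)) => //.
  exact: (subsetP sL).
- by move: cab cS; clear; lia.
Qed.

End Release.

(** * Maximum packings with fewer cherries than the smaller side *)

Section FewCherries.

Variables (G : sgraph) (coK3 : coK3_free G) (U : {set G}).
Implicit Types (P L : {set {set G}}) (C : {set G}).

Lemma maximal_cherry_free P : packing U P ->
    (forall P', packing U P' -> #|P'| <= #|P|) ->
  forall Q : {set G}, Q \subset U :\: cover P -> ~~ cherry Q.
Proof.
move=> packP maxP Q sQ; apply/negP=> chQ.
have [tP cP ch] := packingP _ _ packP.
have pk0 : packing (cover P) P by apply/packingP.
have dis : [disjoint cover P & U :\: cover P].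
  by apply/pred0P=> x; rewrite /= inE; case: (x \in cover P).
have [pk] := packingU dis pk0 (packing1 sQ chQ); rewrite cards1 => cPQ.
have pkU : packing U (P :|: [set Q]).
  by apply: packing_sub pk; rewrite subUset cP subsetDl.
by have := maxP _ pkU; rewrite cPQ addn1 ltnn.
Qed.

(** Of the three vertices of a cherry, at least two lie in exactly one of the two complementary
    sets. *)
Lemma release_dichotomy P C : packing U P ->
  #|[set Q in P | 1 < #|dominators C :&: Q|]|
    + #|[set Q in P | 1 < #|~: dominators C :&: Q|]| = #|P|.
Proof.
case/packingP=> _ _ ch.
rewrite -(cardsID [set Q in P | 1 < #|dominators C :&: Q|] P); congr (_ + _).
  by apply: eq_card => Q; rewrite !inE andbA andbb.
apply: eq_card => Q; rewrite !inE; have [QP|] := boolP (Q \in P); last by rewrite andbF.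
have := card_cherry (ch Q QP); rewrite -(cardsID (dominators C) Q) setDE.
rewrite ![Q :&: _]setIC /=.
by move: #|dominators C :&: Q| #|~: dominators C :&: Q|; clear; lia.
Qed.

(** Let [d_i = a + b - #|P| - #|C_i|] be the deficit of the clique [C_i]; the order of [U] gives
    [d_1 + d_2 = #|P| + 1]. If [admissible_strict] falls short for both cliques, then by
    [release_dichotomy] at least [d_i] cherries have two vertices complete to [C_i]. For the smaller
    deficit [2 * d_i <= #|P| + 1 <= b], so [admissible_loose] applies there. *)
Lemma admissible_few_cherries P a b : packing U P ->
    (forall P', packing U P' -> #|P'| <= #|P|) ->
    #|P| < a -> a <= b -> #|U|.+1 = 2 * (a + b) ->
  admissible U a b.
Proof.
move=> packP maxP ta ab cU.
have [C1 [C2 [restE cl1 cl2 co12]]] := cherry_free_split coK3 (maximal_cherry_free packP maxP).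
have co21 : {in C2 & C1, forall x y, coadj x y}.
  by move=> x y xC yC; rewrite coadj_sym co12.
have restE' : U :\: cover P = C2 :|: C1 by rewrite setUC.
have cR := card_packing_compl packP.
have cC : #|C1| + #|C2| = #|U :\: cover P|.
  rewrite restE cardsU disjoint_setI0 ?cards0 ?subn0 //.
  apply/pred0P=> x /=; apply/negP=> /andP[x1 x2].
  by have := co12 x x x1 x2; rewrite coadj_irr.
rewrite -cC in cR.
have [big1|small1] := leqP (a + b) (#|P| + #|C1|).
  by apply: (admissible_clique packP _ cl1 big1); rewrite restE subsetUl.
have [big2|small2] := leqP (a + b) (#|P| + #|C2|).
  by apply: (admissible_clique packP _ cl2 big2); rewrite restE subsetUr.
(* Both deficits are positive, hence at most [#|P|], so each clique has at least
   [a + b - 2 * #|P| >= 2] vertices. *)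
have card1 : 1 < #|C1| by move: cR ta ab cU small1 small2; clear; lia.
have card2 : 1 < #|C2| by move: cR ta ab cU small1 small2; clear; lia.
pose L C := [set Q in P | 1 < #|~: dominators C :&: Q|].
have sL C : L C \subset P by apply/subsetP=> Q; rewrite inE => /andP[].
have LP C : {in L C, forall Q, 1 < #|~: dominators C :&: Q|}.
  by move=> Q; rewrite inE => /andP[].
have cL C : #|L C| <= b.
  apply: leq_trans (subset_leq_card (sL C)) _.
  exact: ltnW (leq_trans ta ab).
have [strict1|loose1] := leqP (a + b) (#|P| + #|C1| + #|L C2|).
  exact: (admissible_strict coK3 packP restE cl1 co12 maxP card1 card2 (sL C2)).
have [strict2|loose2] := leqP (a + b) (#|P| + #|C2| + #|L C1|).
  exact: (admissible_strict coK3 packP restE' cl2 co21 maxP card2 card1 (sL C1)).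
pose K C := [set Q in P | 1 < #|dominators C :&: Q|].
have sK C : K C \subset P by apply/subsetP=> Q; rewrite inE => /andP[].
have cK C : #|K C| + #|L C| = #|P| := release_dichotomy C packP.
move: (cK C1) (cK C2) => cK1 cK2.
have loose C C' : U :\: cover P = C :|: C' -> clique C ->
    a + b - #|P| - #|C| <= #|K C| -> 2 * (a + b - #|P| - #|C|) <= #|P|.+1 ->
  admissible U a b.
  move=> rE clC dK db; have [L' /subsetP sL' cL'] := subset_of_card dK.
  apply: (admissible_loose packP rE clC (L := L')).
  - by apply/subsetP=> Q /sL'; apply: (subsetP (sK C)).
  - by move=> Q /sL'; rewrite inE => /andP[].
  - by rewrite cL'; apply: leq_trans db (leq_trans ta ab).
  - by rewrite cL'; clear; lia.
have [half|half] := leqP (2 * (a + b - #|P| - #|C1|)) #|P|.+1.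
  by apply: (loose C1 C2) => //; move: cR cU loose1 loose2 small1 small2 cK1 cK2; clear; lia.
apply: (loose C2 C1) => //.
  by move: cR cU loose1 loose2 small1 small2 cK1 cK2; clear; lia.
by move: cR cU small1 small2 half; clear; lia.
Qed.

End FewCherries.

(** * Swapping a vertex of a cherry for an uncovered one *)

Section Swaps.

Variables (G : sgraph) (coK3 : coK3_free G).
Implicit Types (a q v x y z w u : G) (Q : {set G}) (P : {set {set G}}).

Definition non_nbrs v : {set G} := [set u | coadj v u].

(** In a cherry this is the end opposite to an end missed by [v], if there is one. *)
Definition partners v Q : {set G} := [set z in Q | [exists q in Q, coadj v q && coadj q z]].

Lemma set3_swap a x y w : x != y -> w != y -> a |: ([set x; y; w] :\ y) = [set a; x; w].
Proof.
move=> xy wy; apply/setP=> z; rewrite !inE.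
have [->|zy] := eqVneq z y; last by rewrite orbF -orbA.
by rewrite /= ![y == _]eq_sym (negbTE xy) (negbTE wy) !orbF.
Qed.

Lemma set3C x y w : [set x; y; w] = [set y; x; w].
Proof. by rewrite [[set x; y]]setUC. Qed.

(* [forced] is what minimality of the codegree of [v] yields; the swaps of [a] that
   keep a cherry then leave few options for the non-neighbours of [a] in [Q]. *)
Lemma swap_cases Q a v : cherry Q -> a \notin Q -> coadj v a ->
    (forall q, q \in Q -> cherry (a |: (Q :\ q)) -> coadj v q) ->
  (exists q, [/\ q \in Q, cherry (a |: (Q :\ q)) & coadj v q]) /\
  {in Q, forall z, coadj a z -> z \in partners v Q}.
Proof.
case/cherryP=> x [y [w [-> xy wx wy]]]; rewrite !inE !negb_or => /andP[/andP[ax ay] aw] va forced.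
have [nxw nyw] : x != w /\ y != w by rewrite ![_ == w]eq_sym (adj_neq wx) (adj_neq wy).
have nxy := coadj_neq xy; have nwx := adj_neq wx; have nwy := adj_neq wy.
have nyx : y != x by rewrite eq_sym.
have yx : coadj y x by rewrite coadj_sym.
have xw : adj x w by rewrite adj_sym.
have yw : adj y w by rewrite adj_sym.
have swapy : a |: ([set x; y; w] :\ y) = [set a; x; w] by apply: set3_swap.
have swapx : a |: ([set x; y; w] :\ x) = [set a; y; w].
  by rewrite set3C; apply: set3_swap.
have swapw : a |: ([set x; y; w] :\ w) = [set x; y; a].
  by rewrite -setUA [[set y; w]]setUC setUA set3_swap // -setUA setUC.
have no_both : coadj a x -> coadj a y -> False.
  by move=> cax cay; apply: (coK3 (x := x) (y := a) (z := y)) => //; rewrite coadj_sym.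
have adjE u u' : u != u' -> coadj u u' = false -> adj u' u.
  by move=> uu' /negbT; rewrite adj_sym; apply: Ncoadj.
(* If [a] misses the middle [w], an end adjacent to [a] is the middle of a cherry with ends [a] and
   [w], so [v] misses the opposite end. Each subcase then contains a triangle of the complement. *)
have [caw|ncaw] := boolP (coadj a w).
  exfalso.
  have vx : coadj a y = false -> coadj v x.
    move=> cay; apply: forced; rewrite ?inE ?eqxx // swapx setUAC.
    by apply: cherry3 => //; apply: adjE.
  have vy : coadj a x = false -> coadj v y.
    move=> cax; apply: forced; rewrite ?inE ?eqxx ?orbT // swapy setUAC.
    by apply: cherry3 => //; apply: adjE.
  have [cax|/negbTE ncax] := boolP (coadj a x); have [cay|/negbTE ncay] := boolP (coadj a y).
  - exact: no_both.
  - exact: coK3 va cax (vx ncay).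
  - exact: coK3 va cay (vy ncax).
  - exact: coK3 (vx ncay) xy (vy ncax).
move/negbTE: ncaw => ncaw.
have [cax|/negbTE ncax] := boolP (coadj a x).
  have ncay : coadj a y = false by apply/negP; apply: no_both.
  have ch : cherry (a |: ([set x; y; w] :\ y)).
    by rewrite swapy; apply: cherry3 => //; apply: adjE.
  have vy : coadj v y by apply: forced ch; rewrite !inE eqxx orbT.
  split; first by exists y; rewrite !inE eqxx orbT.
  move=> z; rewrite !inE => /orP[/orP[]|] /eqP-> cz; rewrite ?ncay ?ncaw // in cz.
  by rewrite eqxx; apply/exists_inP; exists y; rewrite ?vy // !inE eqxx orbT.
have [cay|/negbTE ncay] := boolP (coadj a y).
  have ch : cherry (a |: ([set x; y; w] :\ x)).
    by rewrite swapx; apply: cherry3 => //; apply: adjE.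
  have vx : coadj v x by apply: forced ch; rewrite !inE eqxx.
  split; first by exists x; rewrite !inE eqxx.
  move=> z; rewrite !inE => /orP[/orP[]|] /eqP-> cz; rewrite ?ncax ?ncaw // in cz.
  by rewrite eqxx orbT; apply/exists_inP; exists x; rewrite ?vx // !inE eqxx.
(* Now [a] is adjacent to all of [Q] and can replace the middle. *)
have ch : cherry (a |: ([set x; y; w] :\ w)).
  by rewrite swapw; apply: cherry3 => //; rewrite adj_sym; apply: adjE.
have vw : coadj v w by apply: forced ch; rewrite !inE eqxx orbT.
split; first by exists w; rewrite !inE eqxx orbT.
by move=> z; rewrite !inE => /orP[/orP[]|] /eqP-> cz; rewrite ?ncax ?ncay ?ncaw // in cz.
Qed.

(** Only the ends have non-neighbours in [Q], and [v] cannot miss both. *)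
Lemma card_partners v Q : cherry Q -> #|partners v Q| <= 1.
Proof.
case/cherryP=> x [y [w [defQ xy wx wy]]].
have only z q : z \in Q -> q \in Q -> coadj q z -> (z == x) && (q == y) || (z == y) && (q == x).
  rewrite defQ !inE => /orP[/orP[]|] /eqP-> /orP[/orP[]|] /eqP->;
   rewrite ?eqxx ?orbT ?coadj_irr ?(adjN wx) ?(adjN wy) // coadj_sym ?(adjN wx) ?(adjN wy) //.
apply/card_le1_eqP=> z z'; rewrite !inE.
case/andP=> zQ /exists_inP[q qQ /andP[vq qz]]; case/andP=> z'Q /exists_inP[q' q'Q /andP[vq' qz']].
have /orP[] := only _ _ zQ qQ qz => /andP[/eqP ez /eqP eq];
  have /orP[] := only _ _ z'Q q'Q qz' => /andP[/eqP ez' /eqP eq']; subst; rewrite ?ez' //.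
- by case: (coK3 vq' xy vq).
- by case: (coK3 vq xy vq').
Qed.

Lemma packing_swap U P Q a q :
    packing U P -> Q \in P -> a \in U :\: cover P -> q \in Q ->
    cherry (a |: (Q :\ q)) ->
  exists P', [/\ packing U P', #|P'| = #|P|, {subset P :\ Q <= P'}
    & U :\: cover P' = q |: ((U :\: cover P) :\ a)].
Proof.
move=> pk QP aW qQ ch; set Q' := a |: _ in ch *.
have sQ' : Q' \subset Q :|: (U :\: cover P).
  apply/subsetP=> x /setU1P[->|/setD1P[_ xQ]]; first by rewrite inE aW orbT.
  by rewrite inE xQ.
have [pk' cP'] := packing_replace pk QP (packing1 sQ' ch).
exists ((P :\ Q) :|: [set Q']); split=> //.
- rewrite cP' cards1 addn1 prednK //; by apply/card_gt0P; exists Q.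
- by move=> Q2 Q2P; rewrite inE Q2P.
have coverE (P1 P2 : {set {set G}}) x : (x \in cover (P1 :|: P2)) = (x \in cover P1) || (x \in cover P2).
  apply/bigcupP/orP=> [[Q2 /setUP[] ? ?]|[] /bigcupP[Q2 ? ?]].
  - by left; apply/bigcupP; exists Q2.
  - by right; apply/bigcupP; exists Q2.
  - by exists Q2; rewrite // inE; apply/orP; left.
  - by exists Q2; rewrite // inE; apply/orP; right.
have cover1E Q2 x : (x \in cover [set Q2]) = (x \in Q2) by rewrite /cover big_set1.
have coverPE x : (x \in cover P) = (x \in cover (P :\ Q)) || (x \in Q).
  by rewrite -{1}(setD1K QP) setUC coverE cover1E.
have disQ x : x \in Q -> x \in cover (P :\ Q) = false.
  move=> xQ; apply/bigcupP=> -[Q2 /setD1P[Q2Q Q2P] xQ2].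
  by case/eqP: Q2Q; apply: packing_disjoint pk Q2P QP xQ2 xQ.
move: aW; rewrite inE coverPE negb_or => /andP[/andP[aP aQ] aU].
have qa : q != a by apply: contraNneq aQ => <-.
apply/setP=> x; rewrite !inE coverE cover1E coverPE !inE !negb_or.
have [->|xq] := eqVneq x q.
  by rewrite disQ //= (negbTE qa) /= (packing_in pk QP qQ).
have [->|xa] := eqVneq x a; first by rewrite andbF.
by rewrite /=.
Qed.

End Swaps.

(** * Two sides of equal size *)

Section Balanced.

Variables (G : sgraph) (coK3 : coK3_free G) (U : {set G}).
Implicit Types (a q v x y z w u : G) (Q : {set G}) (P : {set {set G}}).

Definition rest_codegree P v := #|non_nbrs v :&: (U :\: cover P)|.

Definition optimal P v :=
  [/\ packing U P, v \in U :\: cover P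
    & forall P' v', packing U P' -> #|P'| = #|P| -> v' \in U :\: cover P' ->
      rest_codegree P v <= rest_codegree P' v'].

Lemma exists_optimal P v : packing U P -> v \in U :\: cover P ->
  exists P' v', optimal P' v' /\ #|P'| = #|P|.
Proof.
move=> pk vW.
pose ok (Pv : {set {set G}} * G) :=
  [&& packing U Pv.1, #|Pv.1| == #|P| & Pv.2 \in U :\: cover Pv.1].
have ok0 : ok (P, v) by rewrite /ok /= pk eqxx.
have [[P' v'] /and3P[/= pk' /eqP cP' v'W] minP] :=
  arg_minnP (fun Pv => rest_codegree Pv.1 Pv.2) ok0.
exists P', v'; split=> //; split=> // P2 v2 pk2 cP2 v2W.
by apply: (minP (P2, v2)); rewrite /ok /= pk2 cP2 cP' eqxx.
Qed.

Lemma optimal_swap P v a Q : optimal P v -> a \in U :\: cover P -> coadj v a -> Q \in P ->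
  (exists q, [/\ q \in Q, coadj v q
     & exists P', [/\ optimal P' v, {subset P :\ Q <= P'} & q \in U :\: cover P']]) /\
  {in Q, forall z, coadj a z -> z \in partners v Q}.
Proof.
move=> [pk vW opt] aW va QP.
have [_ _ /(_ Q QP) chQ] := packingP _ _ pk.
have out x : x \in U :\: cover P -> x \notin Q.
  by case/setDP=> _; apply: contra => xQ; apply/bigcupP; exists Q.
have va' : v != a := coadj_neq va.
have codeg P' q : U :\: cover P' = q |: ((U :\: cover P) :\ a) ->
    rest_codegree P' v <= rest_codegree P v /\
    (~~ coadj v q -> rest_codegree P' v < rest_codegree P v).
  rewrite /rest_codegree => WE.
  have aN : a \in non_nbrs v :&: (U :\: cover P) by rewrite inE aW inE va.
  rewrite (cardsD1 a (_ :&: (U :\: cover P))) aN WE; split=> [|nvq].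
    apply: (@leq_trans #|q |: (non_nbrs v :&: (U :\: cover P)) :\ a|).
      apply: subset_leq_card; apply/subsetP=> x; rewrite !inE.
      by case/andP=> -> /orP[->//|/and3P[-> -> ->]]; rewrite orbT.
    by rewrite cardsU1 leq_add2r; case: (_ \notin _).
  rewrite add1n ltnS; apply: subset_leq_card; apply/subsetP=> x; rewrite !inE.
  case/andP=> vx; rewrite vx; have [exq|_ /=] := eqVneq x q; last by case/and3P=> -> -> ->.
  by rewrite -exq vx in nvq.
have [|[q [qQ ch vq]] parts] := swap_cases coK3 chQ (out _ aW) va.
  move=> q qQ ch; apply/negPn/negP=> nvq.
  have [P' [pk' cP' _ WE]] := packing_swap pk QP aW qQ ch.
  have [_ /(_ nvq)] := codeg _ _ WE; rewrite ltnNge opt // WE !inE va' /=.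
  by move: vW; rewrite inE => ->; rewrite orbT.
split=> //; exists q; split=> //.
have [P' [pk' cP' sP' WE]] := packing_swap pk QP aW qQ ch.
exists P'; split=> //; last by rewrite WE !inE eqxx.
split=> //; first by rewrite WE; move: vW; rewrite !inE va' => ->; rewrite orbT.
move=> P2 v2 pk2 cP2 v2W; have [le _] := codeg _ _ WE; apply: leq_trans le _.
by apply: opt; rewrite // cP2.
Qed.

Lemma admissible_balanced_optimal P v : optimal P v -> #|U| = 4 * #|P| + 3 ->
  admissible U #|P|.+1 #|P|.+1.
Proof.
move=> opt cU; have [pk vW _] := opt; have cW := card_packing_compl pk.
set W := U :\: cover P in vW cW; set l := #|P|.+1.
have [tP cP ch] := packingP _ _ pk.
have sWU : W \subset U by apply: subsetDl.
set D := non_nbrs v :&: W.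
have sDW : D \subset W by apply: subsetIr.
have cDW := cardsDS sDW.
have leDW := subset_leq_card sDW.
have [d_small|d_large] := leqP #|D| 1.
  have vWD : v \in W :\: D.
    by apply/setDP; split=> //; apply/negP=> /setIP[]; rewrite inE coadj_irr.
  have cWDv : #|W :\: D| = #|(W :\: D) :\ v|.+1 by rewrite (cardsD1 v (W :\: D)) vWD.
  (* [W] has [l + 2] vertices; at least [l] remain without [v] and its at most one non-neighbour. *)
  have [|M sM cM] := @subset_of_card _ ((W :\: D) :\ v) l.
    by move: cWDv cDW cW cU d_small; rewrite /l; clear; lia.
  have vM : v \notin M by apply/negP=> /(subsetP sM); rewrite !inE eqxx.
  have sMW : v |: M \subset W.
    apply/subsetP=> x /setU1P[->//|/(subsetP sM)].
    by case/setD1P=> _ /setDP[].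
  apply: (@admissible_fill _ U P (v |: M) M) => //.
  - exact: packingD.
  - exact: subset_trans sMW sWU.
  - exact: subsetUr.
  - move=> x y; rewrite inE => /andP[xM /setU1P[->|xM']]; last by rewrite xM' in xM.
    case/setU1P=> [->|/(subsetP sM)]; first by rewrite eqxx.
    case/setD1P=> yv /setDP[yW yD] vy; apply: Ncoadj => //.
    by apply: contra yD => cvy; apply/setIP; rewrite inE.
  - by rewrite cM.
  - by rewrite cardsU1 vM cM /l; clear; lia.
have [a aD] : exists a, a \in D by apply/card_gt0P; apply: leq_trans d_large.
have Dco x : x \in D -> coadj v x /\ x \in W by case/setIP; rewrite inE.
pose A0 := [set x in U | coadj v x && [forall Q in P, forall z in Q, coadj x z ==> (z \in partners v Q)]].
have A0P x : x \in U -> coadj v x ->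
    {in P, forall Q, {in Q, forall z, coadj x z -> z \in partners v Q}} -> x \in A0.
  move=> xU vx H; rewrite inE xU vx; apply/forall_inP=> Q QP; apply/forall_inP=> z zQ.
  by apply/implyP; apply: H.
have A0parts x : x \in A0 -> {in P, forall Q, {in Q, forall z, coadj x z -> z \in partners v Q}}.
  rewrite inE => /and3P[_ _ /forall_inP H] Q QP z zQ.
  by move/forall_inP: (H Q QP) => /(_ z zQ)/implyP.
have A0co x : x \in A0 -> coadj v x by rewrite inE => /and3P[].
have sA0U : A0 \subset U by apply/subsetP=> x; rewrite inE => /and3P[].
have DA0 : D \subset A0.
  apply/subsetP=> x /Dco[vx xW]; apply: A0P => //; first exact: (subsetP sWU).
  by move=> Q QP; have [_] := optimal_swap opt xW vx QP.
(* The vertex [q] exchanged for [a] is in [A0]: within [Q] by the definition of [partners], and for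
   the other cherries, which survive in [P'], by a second application of [optimal_swap], now to [P']
   and [q]. *)
have meetA0 : {in P, forall Q, 0 < #|A0 :&: Q|}.
  move=> Q QP; have [va aW] := Dco a aD.
  have [[q [qQ vq [P' [opt' sP' qW']]]] _] := optimal_swap opt aW va QP.
  apply/card_gt0P; exists q; rewrite inE qQ andbT; apply: A0P => //.
    exact: packing_in pk QP qQ.
  move=> Q2 Q2P z zQ2 qz; have [eQ|nQ] := eqVneq Q2 Q.
    rewrite inE zQ2; apply/exists_inP; exists q; first by rewrite eQ.
    by rewrite vq qz.
  have Q2P' : Q2 \in P' by apply: sP'; rewrite !inE nQ.
  by have [_ /(_ z zQ2)] := optimal_swap opt' qW' vq Q2P'; apply.
have cA0 : #|D| + #|P| <= #|A0|.
  rewrite -(cardsID (cover P) A0) addnC; apply: leq_add.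
    by rewrite (card_trivIsetI A0 tP) -sum1_card; apply: leq_sum.
  apply: subset_leq_card; apply/subsetP=> x xD; have [_ /setDP[_ xP]] := Dco x xD.
  by apply/setDP; rewrite (subsetP DA0).
pose N := [set u in U | [exists x in A0, coadj x u]].
(* Each cherry contributes at most one partner. No vertex of [D] occurs, since with [v] and a vertex
   of [A0] it would form a triangle of the complement. *)
have cN : #|N| <= #|P| + #|W :\: D|.
  rewrite -(cardsID (cover P) N); apply: leq_add.
    rewrite (card_trivIsetI N tP) -sum1_card; apply: leq_sum => Q QP.
    apply: leq_trans (card_partners coK3 v (ch Q QP)).
    apply: subset_leq_card; apply/subsetP=> u /setIP[]; rewrite inE => /andP[_ /exists_inP[x xA xu]] uQ.
    exact: A0parts xA _ QP u uQ xu.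
  apply: subset_leq_card; apply/subsetP=> u /setDP[]; rewrite inE => /andP[uU /exists_inP[x xA xu]] uP.
  apply/setDP; split; [exact/setDP | apply/negP=> /Dco[vu _]].
  exact: coK3 (A0co x xA) xu vu.
have [|A sA cA] := @subset_of_card _ A0 l.
  by move: cA0 d_large; rewrite /l; clear; lia.
have sAU := subset_trans sA sA0U.
have cUAN : #|U| - l - #|N| <= #|U :\: (A :|: N)|.
  rewrite cardsD; have : #|U :&: (A :|: N)| <= l + #|N|.
    apply: leq_trans (subset_leq_card (subsetIr _ _)) _.
    by rewrite -cA cardsU leq_subr.
  by clear; lia.
(* As [#|D| >= 2], [N] has at most [2 * l - 1] vertices; [A] has [l] and [U] has [4 * l - 1], so [l]
   remain. *)
have [|M sM cM] := @subset_of_card _ (U :\: (A :|: N)) l.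
  apply: leq_trans cUAN; move: cN cDW cW cU d_large leDW; rewrite /l; clear; lia.
have AM : A :&: M = set0.
  apply/setP=> x; rewrite !inE; apply/negP=> /andP[xA /(subsetP sM)].
  by rewrite !inE xA.
(* All cherries are given up here; the [2 * l] single vertices suffice. *)
apply: (@admissible_fill _ U set0 (A :|: M) M) => //.
- exact: packing0.
- by rewrite subUset sAU; apply: subset_trans sM (subsetDl _ _).
- exact: subsetUr.
- move=> x y /setDP[/setUP[xA _|->//] yS xy].
  have xA0 := subsetP sA x xA.
  case/setUP: yS => [yA|yM].
    apply: (coadj_clique coK3 (x := v) (C := A0)) => //; last exact: (subsetP sA).
  apply: Ncoadj => //; apply/negP=> cxy; have /setDP[yU] := subsetP sM y yM.
  by case/negP; rewrite inE; apply/orP; right; rewrite inE yU; apply/exists_inP; exists x.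
- by rewrite cM.
- by rewrite cards0 add0n cardsU AM cards0 subn0 cA cM.
Qed.

Lemma admissible_balanced P l : packing U P -> #|P| = l -> #|U| = 4 * l + 3 ->
  admissible U l.+1 l.+1.
Proof.
move=> pk cP cU; have cW := card_packing_compl pk.
have [v vW] : exists v, v \in U :\: cover P.
  by apply/card_gt0P; move: cW cU; rewrite cP; clear; lia.
have [P' [v' [opt cP']]] := exists_optimal pk vW.
rewrite -cP -cP'; apply: admissible_balanced_optimal opt _.
by rewrite cU cP' cP.
Qed.

End Balanced.

(** * Sets with at least [2 * (a + b) - 1] vertices *)

Section LargeOrder.

Variables (G : sgraph) (coK3 : coK3_free G).
Implicit Type U : {set G}.

Lemma exists_max_packing U : exists2 P : {set {set G}}, packing U P &
  forall P', packing U P' -> #|P'| <= #|P|.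
Proof.
have [P pk maxP] := arg_maxnP (fun P : {set {set G}} => #|P|) (packing0 U).
by exists P.
Qed.

Lemma admissible_odd_order U a b :
  a <= b -> #|U|.+1 = 2 * (a + b) -> admissible U a b.
Proof.
move=> ab cU; have [P pk maxP] := exists_max_packing U.
have [few|many] := ltnP #|P| a; first exact: (admissible_few_cherries coK3 pk maxP).
(* [3 * a + b <= 2 * (a + b) - 1] holds exactly when [a < b]. *)
have [lt_ab|le_ba] := ltnP a b.
  have [P' sP' cP'] := subset_of_card many.
  by apply: (admissible_cherries (packing_subset sP' pk) cP'); lia.
have eab : b = a by apply/eqP; rewrite eqn_leq le_ba.
subst b; case: a => [|a] in ab cU many le_ba *; first by lia.
have [P' sP' cP'] := subset_of_card (ltnW many).
by apply: (admissible_balanced coK3 (packing_subset sP' pk) cP'); lia.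
Qed.

Lemma admissible_large_order U a b :
  0 < a + b -> 2 * (a + b) <= #|U|.+1 -> admissible U a b.
Proof.
move=> ab_gt0 cU; have [|U' sU' cU'] := @subset_of_card _ U (2 * (a + b)).-1; first by lia.
apply: (admissible_sub sU'); have [ab|/ltnW ba] := leqP a b.
  by apply: admissible_odd_order; lia.
by apply: admissible_sym; apply: admissible_odd_order; lia.
Qed.

End LargeOrder.

(** * Alternating paths of two involutions *)

Section InvolutionOrbit.

Variables (T : finType) (f g : T -> T) (v : T).
Hypotheses (fK : involutive f) (gK : involutive g) (gv : g v = v).

Let p x := g (f x).

Let p_inj : injective p.
Proof. by move=> x y; rewrite /p => /(inv_inj gK)/(inv_inj fK). Qed.

Let pfp x : p (f (p x)) = f x.
Proof. by rewrite /p fK gK. Qed.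

Let pfv : p (f v) = v.
Proof. by rewrite /p fK. Qed.

(** [f] conjugates [p] to its inverse and, as [g] fixes [v], it sends [v] to the predecessor of [v]
    under [p]. *)
Lemma orbit_closedl x : fconnect p v x -> fconnect p v (f x).
Proof.
move/iter_findex<-; elim: (findex p v x) => [|n IHn] /=.
  by rewrite fconnect_sym // -{2}pfv fconnect1.
by apply: connect_trans IHn _; rewrite fconnect_sym // -(pfp (iter n p v)) fconnect1.
Qed.

Lemma orbit_closedr x : fconnect p v x -> fconnect p v (g x).
Proof.
move=> vx; have := connect_trans (orbit_closedl vx) (fconnect1 p (f x)).
by rewrite /p fK.
Qed.

Let iter_pf n : iter n p (f (iter n p v)) = f v.
Proof. by elim: n => //= n IHn; rewrite -iterS iterSr pfp. Qed.

Let iter_period m n : iter m p v = v -> iter (n * m) p v = v.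
Proof. by move=> pm; elim: n => //= n IHn; rewrite mulSn iterD IHn. Qed.

(* The orbit is an alternating path from [v], so it has at most one other end. *)
Lemma orbit_one_end u w : fconnect p v u -> fconnect p v w ->
  f u = u -> f w = w -> u = w.
Proof.
have period i : f (iter i p v) = iter i p v -> iter (i + i).+1 p v = v.
  by move=> fi; have := iter_pf i; rewrite fi -iterD /= => ->.
(* The periods [2 * i + 1] and [2 * (i + r) + 1] differ by [2 * r], so [2 * r] is a period, and so
   is [r = r * (2 * i + 1) - i * (2 * r)]. *)
have key i r : f (iter i p v) = iter i p v ->
    f (iter (i + r) p v) = iter (i + r) p v -> iter i p v = iter (i + r) p v.
  move=> /period pi /period pir.
  have p2r : iter (r + r) p v = v.
    by move: pir; rewrite (_ : (i + r + (i + r)).+1 = (r + r) + (i + i).+1) ?iterD ?pi //; lia.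
  have pr : iter r p v = v.
    have := iter_period r pi; rewrite (_ : r * (i + i).+1 = r + i * (r + r)); last by lia.
    by rewrite iterD iter_period.
  by rewrite iterD pr.
move=> /iter_findex <- /iter_findex <-.
move: (findex p v u) (findex p v w) => i j fi fj.
have [ij|/ltnW ji] := leqP i j.
  by rewrite -(subnKC ij) in fj *; apply: key.
by rewrite -(subnKC ji) in fi *; apply/esym/key.
Qed.

End InvolutionOrbit.

(** * Matchings of the complement and the colourings they give *)

Section Comatchings.

Variable G : sgraph.
Implicit Types (U : {set G}) (s f g h : {ffun G -> G}) (x y u v w : G).

(* A matching of the complement of [G[U]], encoded as an involution. *)
Definition comatching U s : bool :=
  [forall x, [&& s (s x) == x, ~~ adj x (s x) & (x \notin U) ==> (s x == x)]].

Lemma comatchingP U s :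
  reflect [/\ involutive s, forall x, ~~ adj x (s x) & forall x, x \notin U -> s x = x]
          (comatching U s).
Proof.
apply: (iffP forallP) => [H|[sK sN sU] x].
  by split=> x; have /and3P[/eqP ? ? /implyP ?] := H x => // xU; apply/eqP; auto.
by rewrite sK eqxx sN; apply/implyP=> /sU ->.
Qed.

Definition unmatched U s : {set G} := [set x in U | s x == x].

Lemma comatching_stable U s x : comatching U s -> x \in U -> s x \in U.
Proof.
case/comatchingP=> sK _ sU xU; apply/negPn/negP=> sxU; case/negP: (sxU).
by have := sU _ sxU; rewrite sK => <-.
Qed.

Lemma involution_half s : involutive s -> exists I : {set G},
  [/\ 2 * #|I| = #|G| + #|unmatched setT s|, forall x, (x \in I) || (s x \in I)
    & forall x, x \in I -> s x \in I -> s x = x].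
Proof.
move=> sK; pose I := [set x : G | enum_rank x <= enum_rank (s x)].
have s_inj := can_inj sK.
have IP x : x \in I -> s x \in I -> s x = x.
  rewrite !inE sK => le1 le2; apply/enum_rank_inj/val_inj/eqP.
  by rewrite eqn_leq le1 le2.
have IU x : (x \in I) || (s x \in I) by rewrite !inE sK leq_total.
exists I; split=> //.
have ->: unmatched setT s = I :&: (s @^-1: I).
  apply/setP=> x; rewrite inE in_setT in_setI [x \in _ @^-1: _]inE.
  apply/eqP/andP=> [e|[]]; last exact: IP.
  by have := IU x; rewrite e orbb => ->.
have -> : #|G| = #|I :|: (s @^-1: I)|.
  rewrite -cardsT; congr #|pred_of_set _|.
  by apply/setP=> x; rewrite in_setT in_setU [x \in _ @^-1: _]inE IU.
by rewrite cardsUI card_preimset // mul2n addnn.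
Qed.

Lemma comatching_even U s : comatching U s -> ~~ odd (#|U| + #|unmatched U s|).
Proof.
case/comatchingP=> sK _ sU; have [I [cI _ _]] := involution_half sK.
have cT : #|unmatched setT s| = #|unmatched U s| + #|~: U|.
  rewrite -(cardsID U (unmatched setT s)); congr (_ + _); apply: eq_card => x.
    by rewrite !inE andbC.
  by rewrite !inE; have [//|/sU->] := boolP (x \in U); rewrite eqxx.
have cC := cardsC U.
have -> : #|U| + #|unmatched U s| = 2 * (#|I| - #|~: U|) by lia.
by rewrite oddM.
Qed.

(* A comatching colours [G[U]] with [(#|U| + #|unmatched U s|) / 2] colours: its
   non-trivial orbits and its unmatched vertices. *)
Definition needs_colours U k : bool :=
  [forall s, comatching U s ==> (2 * k <= #|U| + #|unmatched U s|)].

Lemma needs_coloursP U k :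
  reflect (forall s, comatching U s -> 2 * k <= #|U| + #|unmatched U s|) (needs_colours U k).
Proof.
apply: (iffP forallP) => H s; first by have /implyP := H s.
by apply/implyP; apply: H.
Qed.

(** Colouring each vertex by the representative in [I] of its orbit is proper, as [x] and [s x] are
    never adjacent, and uses [#|I|] colours. *)
Lemma needs_chromatic_number : needs_colours setT (chromatic_number G).
Proof.
apply/needs_coloursP=> s /comatchingP[sK sN _].
have [I [cI IU _]] := involution_half sK.
rewrite cardsT -cI leq_mul2l /= /chromatic_number; case: ex_minnP => k _; apply.
pose r x := if x \in I then x else s x.
have rI x : r x \in I by rewrite /r; case: ifP => // xI; have := IU x; rewrite xI.
apply/existsP; exists [ffun x => enum_rank_in (rI x) (r x)].
apply/forallP=> x; apply/forallP=> y; apply/implyP=> xy; rewrite !ffunE.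
apply: contraTneq xy => /(congr1 enum_val); rewrite !enum_rankK_in //.
rewrite /r; case: ifP => _; case: ifP => _.
- by move->; rewrite adj_irr.
- by move->; rewrite adj_sym.
- by move<-.
- by move/(can_inj sK)->; rewrite adj_irr.
Qed.

Lemma comatching_id U : comatching U [ffun x => x].
Proof. by apply/comatchingP; split=> x; rewrite !ffunE // adj_irr. Qed.

Lemma unmatched_id U : unmatched U [ffun x => x] = U.
Proof. by apply/setP=> x; rewrite !inE ffunE eqxx andbT. Qed.

(** Maximum matchings of the two parts combine to a matching of the union, so their colour counts,
    integers by [comatching_even], add up to at least [k]. *)
Lemma needs_colours_join U1 U2 k : {in U1 & U2, forall x y, adj x y} ->
    needs_colours (U1 :|: U2) k ->
  exists k1 k2, [/\ k1 + k2 = k, needs_colours U1 k1 & needs_colours U2 k2].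
Proof.
move=> U12 /needs_coloursP Uk.
have dU x : x \in U1 -> x \in U2 -> False by move=> x1 x2; have := U12 x x x1 x2; rewrite adj_irr.
have best U : exists2 s, comatching U s & forall s', comatching U s' ->
    #|unmatched U s| <= #|unmatched U s'|.
  have [s ms mins] := arg_minnP (fun s => #|unmatched U s|) (comatching_id U).
  by exists s.
have [s1 m1 min1] := best U1; have [s2 m2 min2] := best U2.
have [s1K s1N s1U] := comatchingP _ _ m1; have [s2K s2N s2U] := comatchingP _ _ m2.
pose s := [ffun x => if x \in U1 then s1 x else s2 x].
have s2U1 x : x \notin U1 -> s2 x \notin U1.
  move=> xU1; have [xU2|/s2U->//] := boolP (x \in U2).
  by apply/negP=> sx; apply: (dU _ sx); apply: comatching_stable m2 xU2.
have ms : comatching (U1 :|: U2) s.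
  apply/comatchingP; split=> x; rewrite /s !ffunE.
  - have [xU|xU] := boolP (x \in U1); first by rewrite (comatching_stable m1 xU) s1K.
    by rewrite (negbTE (s2U1 _ xU)) s2K.
  - by case: ifP.
  - by rewrite inE negb_or => /andP[/negbTE-> /s2U].
have cU : #|U1 :|: U2| = #|U1| + #|U2|.
  rewrite cardsU disjoint_setI0 ?cards0 ?subn0 //.
  by apply/pred0P=> x /=; apply/negP=> /andP[/dU].
have cs : #|unmatched (U1 :|: U2) s| = #|unmatched U1 s1| + #|unmatched U2 s2|.
  rewrite -(cardsID U1 (unmatched _ s)); congr (_ + _); apply: eq_card => x.
    by rewrite !inE ffunE; case: (x \in U1); rewrite ?andbF //= andbT.
  rewrite !inE ffunE; have [xU|xU] //= := boolP (x \in U1).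
  by apply/esym/negP=> /andP[/(dU x xU)].
have := Uk _ ms; rewrite cU cs => le_k.
have ev1 := comatching_even m1; have ev2 := comatching_even m2.
pose h1 := (#|U1| + #|unmatched U1 s1|)./2.
exists (minn k h1), (k - minn k h1); split; first by lia.
- apply/needs_coloursP=> s' /min1; rewrite /h1; lia.
- apply/needs_coloursP=> s' /min2; rewrite /h1; lia.
Qed.

End Comatchings.

(** * Gallai's lemma for the complement *)

Section Gallai.

Variables (G : sgraph) (U : {set G}) (m : nat).
Implicit Types (s f g h : {ffun G -> G}) (x y u v w : G).
Hypothesis m_min : forall s, comatching U s -> m <= #|unmatched U s|.

Definition maximum s := comatching U s && (#|unmatched U s| == m).

Hypothesis missable : forall v, v \in U -> exists2 s, maximum s & s v = v.

(** By [missable] each vertex of [U] is missed by some maximum matching, so reflexivity has to be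
    put in by hand. *)
Definition linked u w : bool :=
  (u == w) || ~~ [exists s, [&& maximum s, s u == u & s w == w]].

Lemma linkedP u w :
  reflect (u = w \/ forall s, maximum s -> s u = u -> s w = w -> False) (linked u w).
Proof.
apply: (iffP orP) => -[].
- by move/eqP; left.
- by move/existsPn=> H; right=> s ms su sw; have := H s; rewrite ms su sw !eqxx.
- by move->; left.
- by move=> H; right; apply/existsPn=> s; apply/negP=> /and3P[ms /eqP su /eqP]; apply: H.
Qed.

(* Exchanging two maximum matchings along the component of [v] in their union. *)
Lemma exchange f g v z : maximum f -> maximum g -> g v = v -> f z = z ->
    ~~ fconnect (fun x => g (f x)) v z ->
  exists h, [/\ maximum h, h v = v & h z = z].
Proof.
case/andP=> mf /eqP cf /andP[mg /eqP cg] gv fz vz.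
have [fK fN fU] := comatchingP _ _ mf; have [gK gN gU] := comatchingP _ _ mg.
pose O := [set x | fconnect (fun x => g (f x)) v x].
have Of x : (f x \in O) = (x \in O).
  rewrite !inE; apply/idP/idP; last exact: orbit_closedl.
  by move/(orbit_closedl fK gK gv); rewrite fK.
have Og x : (g x \in O) = (x \in O).
  rewrite !inE; apply/idP/idP; last exact: orbit_closedr.
  by move/(orbit_closedr fK gK gv); rewrite gK.
pose h1 := [ffun x => if x \in O then g x else f x].
pose h2 := [ffun x => if x \in O then f x else g x].
have mh1 : comatching U h1.
  apply/comatchingP; split=> x; rewrite /h1 !ffunE.
  - by case xO : (x \in O); rewrite ?Of ?Og xO.
  - by case: ifP.
  - by move=> xU; rewrite fU ?gU ?if_same.
have mh2 : comatching U h2.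
  apply/comatchingP; split=> x; rewrite /h2 !ffunE.
  - by case xO : (x \in O); rewrite ?Of ?Og xO.
  - by case: ifP.
  - by move=> xU; rewrite fU ?gU ?if_same.
(* The sum is [2 * m] and both terms are at least [m], so [h1] is maximum. *)
have split_h : #|unmatched U h1| + #|unmatched U h2| = #|unmatched U f| + #|unmatched U g|.
  rewrite -!(cardsID O (unmatched U _)).
  have -> : unmatched U h1 :&: O = unmatched U g :&: O.
    apply/setP=> x; rewrite ![x \in _ :&: _]inE ![x \in unmatched _ _]inE ffunE.
    by case: (x \in O); rewrite ?andbF.
  have -> : unmatched U h1 :\: O = unmatched U f :\: O.
    apply/setP=> x; rewrite ![x \in _ :\: _]inE ![x \in unmatched _ _]inE ffunE.
    by case: (x \in O).
  have -> : unmatched U h2 :&: O = unmatched U f :&: O.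
    apply/setP=> x; rewrite ![x \in _ :&: _]inE ![x \in unmatched _ _]inE ffunE.
    by case: (x \in O); rewrite ?andbF.
  have -> : unmatched U h2 :\: O = unmatched U g :\: O.
    apply/setP=> x; rewrite ![x \in _ :\: _]inE ![x \in unmatched _ _]inE ffunE.
    by case: (x \in O).
  by lia.
have ch1 : #|unmatched U h1| = m.
  by move: (m_min mh1) (m_min mh2) split_h; rewrite cf cg; clear; lia.
exists h1; split; first by rewrite /maximum mh1 ch1 eqxx.
  by rewrite ffunE inE connect0.
by rewrite ffunE inE (negbTE vz).
Qed.

(** Let [f] miss both [u] and [w], and [g] miss [v]. By [orbit_one_end] the alternating path from
    [v] avoids [u] or [w]; exchanging along it gives a maximum matching missing [v] and that
    vertex. *)
Lemma linked_trans u v w : v \in U -> linked u v -> linked v w -> linked u w.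
Proof.
move=> vU /linkedP[->//|uv] /linkedP[<-|vw]; first by apply/linkedP; right.
have [->|uw] := eqVneq u w; first by rewrite /linked eqxx.
apply/linkedP; right=> f mf fu fw; have [g mg gv] := missable vU.
have [fK _ _] := comatchingP _ _ (proj1 (andP mf)).
have [gK _ _] := comatchingP _ _ (proj1 (andP mg)).
have [vu|vu] := boolP (fconnect (fun x => g (f x)) v u).
  have [vw'|vw'] := boolP (fconnect (fun x => g (f x)) v w).
    by case/eqP: uw; apply: (orbit_one_end fK gK gv).
  have [h [mh hv hw]] := exchange mf mg gv fw vw'.
  exact: vw mh hv hw.
have [h [mh hv hu]] := exchange mf mg gv fu vu.
exact: uv mh hu hv.
Qed.

(** A maximum matching missing both could be enlarged by the pair [x], [y]. *)
Lemma coadj_linked x y : x \in U -> y \in U -> coadj x y -> linked x y.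
Proof.
move=> xU yU xy; apply/linkedP; right=> s /andP[ms /eqP cs] sx sy.
have [sK sN sU] := comatchingP _ _ ms.
have nxy := coadj_neq xy.
have sne z : z != x -> z != y -> (s z == x = false) * (s z == y = false).
  move=> zx zy; split; apply/eqP=> e; have := sK z; rewrite e ?sx ?sy => e'.
    by rewrite e' eqxx in zx.
  by rewrite e' eqxx in zy.
pose h := [ffun z => if z == x then y else if z == y then x else s z].
have mh : comatching U h.
  apply/comatchingP; split=> z; rewrite /h !ffunE.
  - have [->|zx] := eqVneq z x; first by rewrite eq_sym (negbTE nxy) eqxx.
    have [->|zy] := eqVneq z y; first by rewrite eqxx.
    by rewrite !sne.
  - have [->|zx] := eqVneq z x; first by rewrite (coadjN xy).
    have [->|zy] := eqVneq z y; first by rewrite adj_sym (coadjN xy).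
    exact: sN.
  - move=> zU; have [e|_] := eqVneq z x; first by rewrite e xU in zU.
    have [e|_] := eqVneq z y; first by rewrite e yU in zU.
    exact: sU.
have := m_min mh; rewrite -cs leqNgt => /negP; apply.
apply/proper_card/properP; split.
  apply/subsetP=> z; rewrite !inE ffunE => /andP[->] /=.
  have [->|_] := eqVneq z x; first by rewrite eq_sym (negbTE nxy).
  by have [->|_] := eqVneq z y; first by rewrite (negbTE nxy).
exists x; first by rewrite inE xU sx eqxx.
by rewrite inE ffunE eqxx eq_sym (negbTE nxy) andbF.
Qed.

(** If [m >= 2], two vertices missed together are not linked, so being linked to one of them splits
    [U] properly. By transitivity and [coadj_linked] no non-edge crosses. *)
Lemma gallai : m <= 1 \/ exists U1 U2 : {set G},
  [/\ U = U1 :|: U2, U1 \proper U, U2 \proper U & {in U1 & U2, forall x y, adj x y}].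
Proof.
have [|m_gt1] := leqP m 1; [by left | right].
have [s0|] := altP (set0Pn (T := G) U); last first.
  rewrite negbK => /eqP U0; have := m_min (comatching_id U); rewrite unmatched_id U0 cards0.
  by move=> /(leq_trans m_gt1).
have [v0 v0U] := s0; have [s ms _] := missable v0U.
have /andP[cms /eqP cs] := ms; move: m_gt1; rewrite -cs => /card_gt1P[u [w []]].
rewrite !inE => /andP[uU /eqP su] /andP[wU /eqP sw] uw.
have nuw : ~~ linked u w.
  by apply/linkedP=> -[e|H]; [rewrite e eqxx in uw | apply: (H s)].
exists [set x in U | linked u x], [set x in U | ~~ linked u x]; split.
- by apply/setP=> x; rewrite !inE -andb_orr orbN andbT.
- apply/properP; split; first by apply/subsetP=> x; rewrite inE => /andP[].
  by exists w; rewrite // inE (negbTE nuw) andbF.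
- apply/properP; split; first by apply/subsetP=> x; rewrite inE => /andP[].
  by exists u; rewrite // inE /linked eqxx andbF.
move=> x y; rewrite !inE => /andP[xU ux] /andP[yU uy].
apply: Ncoadj; first by apply: contraNneq uy => <-.
by apply: contra uy => /(coadj_linked xU yU); apply: linked_trans.
Qed.

End Gallai.

(** * Induction on the number of vertices *)

Section Induction.

Variables (G : sgraph) (coK3 : coK3_free G).
Implicit Type U : {set G}.

(** A matching of [U :\ v] that refutes the bound leaves [v] unmatched in [U], where its count is
    larger by 2. The count is even, at least [2 * k] and below [2 * k + 2]. *)
Lemma critical_missable U k v : v \in U -> needs_colours U k ->
    ~~ needs_colours (U :\ v) k ->
  exists s, [/\ comatching U s, #|U| + #|unmatched U s| = 2 * k & s v = v].
Proof.
move=> vU /needs_coloursP Uk /forallPn[s]; rewrite negb_imply -ltnNge => /andP[ms lt_k].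
have [sK sN sU] := comatchingP _ _ ms.
have sv : s v = v by apply: sU; rewrite !inE eqxx.
have msU : comatching U s.
  by apply/comatchingP; split=> // x xU; apply: sU; rewrite inE (negbTE xU) andbF.
have cU : #|U| = #|U :\ v|.+1 by rewrite (cardsD1 v U) vU.
have cs : #|unmatched U s| = #|unmatched (U :\ v) s|.+1.
  rewrite (cardsD1 v (unmatched U s)) inE vU sv eqxx; congr _.+1.
  by apply: eq_card => x; rewrite !inE andbA.
exists s; split=> //.
by have := comatching_even msU; have := Uk s msU; rewrite cU cs in lt_k *; lia.
Qed.

Lemma admissible_needs_colours U a b : needs_colours U (a + b) -> admissible U a b.
Proof.
have [n leU] := ubnP #|U|; elim: n U a b leU => // n IHn U a b; rewrite ltnS => leU Uk.
have [ab0|ab_gt0] := posnP (a + b).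
  exists set0, set0, set0; rewrite !sub0set !cards0 ab0.
  by split; split=> //; [apply: packing0 | move=> x y; rewrite inE].
have [/exists_inP[v vU vk]|crit] := boolP [exists v in U, needs_colours (U :\ v) (a + b)].
  apply: (admissible_sub (subsetDl U [set v])); apply: IHn => //.
  by rewrite (cardsD1 v U) vU in leU.
have miss v : v \in U -> exists s,
    [/\ comatching U s, #|U| + #|unmatched U s| = 2 * (a + b) & s v = v].
  by move=> vU; apply: critical_missable => //; apply: contra crit => vk; apply/exists_inP; exists v.
pose m := 2 * (a + b) - #|U|.
have m_min s : comatching U s -> m <= #|unmatched U s|.
  by move=> ms; have /needs_coloursP/(_ s ms) := Uk; rewrite /m; lia.
have missable v : v \in U -> exists2 s, maximum U m s & s v = v.
  case/miss=> s [ms cs sv]; exists s => //; rewrite /maximum ms /=.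
  by apply/eqP; rewrite /m; lia.
have [m_le1|[U1 [U2 [defU sU1 sU2 U12]]]] := gallai m_min missable.
  by apply: admissible_large_order => //; move: m_le1; rewrite /m; lia.
have [|k1 [k2 [k12 U1k U2k]]] := needs_colours_join U12 (k := a + b); first by rewrite -defU.
(* [U1] supplies [a1] and [k1 - a1] branch sets to the two sides; what the first side still lacks is
   at most [k2] because [a <= k1 + k2]. *)
pose a1 := minn a k1.
have -> : a = a1 + (a - a1) by rewrite /a1; lia.
have -> : b = (k1 - a1) + (k2 - (a - a1)) by rewrite /a1; lia.
rewrite defU; apply: admissible_join => //; apply: IHn.
- exact: leq_trans (proper_card sU1) leU.
- by rewrite subnKC // geq_minr.
- exact: leq_trans (proper_card sU2) leU.
- by rewrite subnKC //; rewrite /a1; lia.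
Qed.

End Induction.

Theorem theorem1p6 (G : sgraph) (alphaG : independence_number G <= 2)
    (l : nat) (l_gt0 : 0 < l) (l_lt_chi : l < chromatic_number G) :
  odd_minor (complete_bipartite l (chromatic_number G - l)) G.
Proof.
have coK3 := independence_coK3_free alphaG.
apply: admissible_odd_minor => //; apply: admissible_needs_colours => //.
by rewrite subnKC ?needs_chromatic_number // ltnW.
Qed.
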